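(* Let $\alpha\in(0,1)$, $E>0$, $\eta>0$, and put $\tau=\eta/E$. Let $\sigma:[0,1]\to\mathbb{R}$ be a continuous function. Then the solution of the fractional initial value problem $$\eta^{\alpha}\left({}^{C}D_{0}^{\alpha}\epsilon\right)(t)+E^{\alpha}\epsilon(t)=\sigma(t),\quad 0<t\leq 1,\qquad \epsilon(0)=0,$$ is $$\epsilon(t)=\frac{1}{\eta^{\alpha}}\int_{0}^{t}(t-s)^{\alpha-1}E_{\alpha,\alpha}\left(-\left(\frac{t-s}{\tau}\right)^{\alpha}\right)\sigma(s)\,ds,\quad 0\leq t\leq 1.$$
   Context: ${}^{C}D_{0}^{\alpha}$ denotes the Caputo fractional derivative of order $\alpha\in(0,1)$ with base point $0$: $\left({}^{C}D_{0}^{\alpha}\epsilon\right)(t)=\frac{1}{\Gamma(1-\alpha)}\frac{d}{dt}\int_0^t (t-s)^{-\alpha}\left(\epsilon(s)-\epsilon(0)\right)ds$ (which equals $\frac{1}{\Gamma(1-\alpha)}\int_0^t (t-s)^{-\alpha}\epsilon'(s)\,ds$ when $\epsilon$ is absolutely continuous). Solutions are sought in $C[0,1]$, the space of continuous real functions on $[0,1]$. The two-parameter Mittag-Leffler function is $E_{\alpha,\beta}(z)=\sum_{n=0}^{\infty}\frac{z^{n}}{\Gamma(\alpha n+\beta)}$ for $\alpha,\beta>0$, $z\in\mathbb{C}$, where $\Gamma$ is the Gamma function. The constant $E$ (no subscript) is a positive real number and is unrelated to the functions $E_{\alpha,\beta}$. *)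

(* Defs.v *)
From HB Require Import structures.
From mathcomp Require Import all_boot all_order all_algebra.
From mathcomp Require Import all_classical all_reals all_analysis.

Set Implicit Arguments.
Unset Strict Implicit.
Unset Printing Implicit Defensive.

Import Order.TTheory GRing.Theory Num.Theory.
Import numFieldNormedType.Exports.

Local Open Scope classical_set_scope.
Local Open Scope ring_scope.

(* Euler's integral; only meaningful for x > 0. *)
Definition Gamma (R : realType) (x : R) : R :=
  \int[@lebesgue_measure R]_(t in `]0, +oo[) (t `^ (x - 1) * expR (- t)).

(* E_{alpha,beta}(z), at real arguments z. *)
Definition mittag_leffler (R : realType) (alpha beta z : R) : R :=
  limn (series (fun n : nat => z ^+ n / Gamma (alpha * n%:R + beta))).

(* The difference quotient of f at t along A `\ t: for A = `[0, 1] its limit is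
   the usual derivative at interior points, and the one-sided one at 0 and 1. *)
Definition diff_quot_within (R : realType) (A : set R) (f : R -> R) (t : R) :
    set_system R :=
  (fun x => (f x - f t) / (x - t)) @ within A t^'.

Definition derivable_within (R : realType) (A : set R) (f : R -> R) (t : R) :
    Prop :=
  cvg (diff_quot_within A f t).

Definition derive_within (R : realType) (A : set R) (f : R -> R) (t : R) : R :=
  lim (diff_quot_within A f t).

(* A function on [0, 1] is represented by a total function R -> R; everything
   below depends only on its values on [0, 1].
   The value of the kernel at s = t is immaterial (0 `^ (- alpha) = 0 for
   alpha != 0). *)
Definition caputo_integral (R : realType) (alpha : R) (eps : R -> R) (t : R) :
    R :=
  \int[@lebesgue_measure R]_(s in `[0, t])
    ((t - s) `^ (- alpha) * (eps s - eps 0)).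

Definition caputo_derivable (R : realType) (alpha : R) (eps : R -> R) (t : R) :
    Prop :=
  derivable_within `[0, 1] (caputo_integral alpha eps) t.

Definition caputo (R : realType) (alpha : R) (eps : R -> R) (t : R) : R :=
  (Gamma (1 - alpha))^-1 *
  derive_within `[0, 1] (caputo_integral alpha eps) t.

Definition is_ivp_solution (R : realType) (alpha E eta : R)
    (sigma eps : R -> R) : Prop :=
  [/\ {within `[0, 1], continuous eps},
      eps 0 = 0 &
      forall t : R, 0 < t <= 1 ->
        caputo_derivable alpha eps t /\
        eta `^ alpha * caputo alpha eps t + E `^ alpha * eps t = sigma t].

(* Main.v *)
Require Import Defs.
From HB Require Import structures.
From mathcomp Require Import all_boot all_order all_algebra.
From mathcomp Require Import all_classical all_reals all_analysis.
From mathcomp Require Import measurable_realfun.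
From mathcomp Require Import ring.

Import Order.TTheory GRing.Theory Num.Theory.
Import numFieldNormedType.Exports.

Local Open Scope classical_set_scope.
Local Open Scope ring_scope.

Set Implicit Arguments.
Unset Strict Implicit.
Unset Printing Implicit Defensive.

(** Write g_a(t) for the Riemann-Liouville kernel t^(a-1) / Gamma(a) on t > 0,
    extended by 0 to t <= 0, and f * g for convolution.  All functions here
    vanish on t <= 0, so (f * g)(t) is an integral over the whole line although
    only 0 < s < t contributes.  The proof is an algebra in which everything is
    a convolution:

    - g_a * g_b = g_(a+b): this is Euler's beta integral, obtained by computing
      the integral of exp(-x) (t^(a-1) * t^(b-1))(x) in two ways
      ([integral_rlker]).  In particular g_alpha * g_(1-alpha) = g_1, and
      convolving with g_1 is integrating from 0.

    - Convolution is commutative and associative on the class of functions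
      bounded on t <= 1 by a multiple of some g_a ([convC], [convA]).

    - The kernel h(t) = t^(alpha-1) E_(alpha,alpha)(-lam t^alpha) is the sum of
      (-lam)^n g_(alpha n + alpha), so it satisfies the resolvent equation
      h = g_alpha - lam g_alpha * h ([ml_kernel_resolvent]).  By associativity,
      the Volterra equation e = g_alpha * (k sigma - lam e) is then equivalent
      to e = k h * sigma ([volterra_ml_kernel]).

    It remains to relate the initial value problem to the Volterra equation.
    The Caputo integral is Gamma(1-alpha) g_(1-alpha) * eps, so with
    k = eta^(-alpha), lam = tau^(-alpha) and D = k sigma - lam eps the problem
    says that g_(1-alpha) * eps has derivative D on ]0, 1].

    From the Volterra equation, g_(1-alpha) * eps = g_(1-alpha) * g_alpha * D
    = g_1 * D, whose derivative is D by the fundamental theorem of calculus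
    ([ml_caputo_equation]).  Conversely, if g_(1-alpha) * eps has derivative D,
    it equals g_1 * D by the mean value theorem; convolving with g_alpha gives
    g_1 * (eps - g_alpha * D) = 0, and differentiating gives the Volterra
    equation ([caputo_equation_ml]).  Both directions need the continuity of
    g_a * u for bounded u, which comes from the Hoelder estimate
    [conv_rlker_holder]. *)

(** * Affine changes of variables in Lebesgue integrals *)

Section ChangeOfVariables.
Context {R : realType}.
Notation mu := (@lebesgue_measure R).

Lemma measurable_affine (c d : R) :
  measurable_fun [set: R] (fun x : R => c * x + d).
Proof.
apply: measurable_funD => //; exact: measurable_funM.
Qed.

(** Lebesgue measure is characterized by its values on the intervals ]a, b], so
    comparing lengths is enough. *)
Lemma lebesgue_measure_affine (c d : R) (A : set R) : 0 < c -> measurable A ->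
  pushforward mu (fun x : measurableTypeR R => (c * x + d : measurableTypeR R)) A
  = (c^-1%:E * mu A)%E.
Proof.
move=> c0 mA.
pose nc : {nonneg R} := NngNum (ltW c0).
pose phi := fun x : measurableTypeR R => (c * x + d : measurableTypeR R).
have mphi : measurable_fun setT phi := measurable_affine c d.
(* The pushforward is named as a measure before it is rescaled by c. *)
have [pm pmE] : exists pm : {measure set (measurableTypeR R) -> \bar R},
    forall B, pm B = mu (phi @^-1` B).
  by unshelve eexists (pushforward mu phi).
have E : mu A = mscale nc pm A.
  apply: lebesgue_measure_unique => //= _ [[a b]] _ <-.
  rewrite /mscale /= pmE.
  have -> : phi @^-1` `]a, b]%classic = `](a - d) / c, (b - d) / c]%classic.
    apply/funext => x; rewrite /preimage/= !in_itv/= /phi.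
    by rewrite ltr_pdivrMr// ler_pdivlMr// ltrBlDr lerBrDr ![x * c]mulrC.
  rewrite !lebesgue_measure_itv/= !lte_fin ltr_pM2r ?invr_gt0// ltrBlDr subrK.
  case: ifPn => _; last by rewrite mule0.
  by rewrite -EFinB -EFinM; congr EFin; field; rewrite gt_eqF.
rewrite E /mscale/= pmE muleA -EFinM mulVf ?gt_eqF// mul1e.
by [].
Qed.
End ChangeOfVariables.

Section Integrals.
Context {R : realType}.
Notation mu := (@lebesgue_measure R).
Local Open Scope ereal_scope.

Lemma ge0_integral_affine (c d : R) (f : R -> \bar R) : (0 < c)%R ->
  measurable_fun [set: R] f -> (forall x, 0 <= f x) ->
  \int[mu]_x f (c * x + d)%R = c^-1%:E * \int[mu]_x f x.
Proof.
move=> c0 mf f0.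
have c0' : (0 <= c^-1)%R by rewrite invr_ge0 ltW.
pose nc : {nonneg R} := NngNum c0'.
pose phi := fun x : measurableTypeR R => (c * x + d : measurableTypeR R)%R.
have mphi : measurable_fun setT phi := measurable_affine c d.
transitivity (\int[pushforward mu phi]_y f y).
  by rewrite ge0_integral_pushforward//= => x _; exact: f0.
rewrite (eq_measure_integral (mscale nc mu)); last first.
  by move=> A mA _; rewrite [LHS](lebesgue_measure_affine d c0 mA).
by rewrite (ge0_integral_mscale _ _ nc).
Qed.

Lemma ge0_integral_opp (f : R -> \bar R) :
  measurable_fun [set: R] f -> (forall x, 0 <= f x) ->
  \int[mu]_x f (- x)%R = \int[mu]_x f x.
Proof.
move=> mf f0.
transitivity (\int[pushforward mu (-%R : _ -> measurableTypeR R)]_y f y).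
  by rewrite ge0_integral_pushforward//= => x _; exact: f0.
by apply: eq_measure_integral => //= A mA AS; exact: lebesgue_measureN.
Qed.

(** The integral of a signed function is the difference of the integrals of its
    positive and negative parts, each of which is translation invariant. *)
Lemma integral_shift (d : R) (f : R -> \bar R) : measurable_fun [set: R] f ->
  \int[mu]_x f (x + d)%R = \int[mu]_x f x.
Proof.
move=> mf; rewrite [LHS]integralE [RHS]integralE.
have shift g : measurable_fun [set: R] g -> (forall x, 0 <= g x) ->
    \int[mu]_x g (x + d)%R = \int[mu]_x g x.
  move=> mg g0; have := ge0_integral_affine d ltr01 mg g0.
  by rewrite invr1 mul1e => <-; under [in RHS]eq_integral do rewrite mul1r.
congr (_ - _).
  rewrite -(shift _ (measurable_funepos mf))//.
  by apply: eq_integral => x _; exact: (congr1 (@^~ x) (funepos_comp f (+%R^~ d))).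
rewrite -(shift _ (measurable_funeneg mf))//.
by apply: eq_integral => x _; exact: (congr1 (@^~ x) (funeneg_comp f (+%R^~ d))).
Qed.

Lemma integral_opp (f : R -> \bar R) : measurable_fun [set: R] f ->
  \int[mu]_x f (- x)%R = \int[mu]_x f x.
Proof.
move=> mf; rewrite [LHS]integralE [RHS]integralE.
congr (_ - _).
  rewrite -(ge0_integral_opp (measurable_funepos mf))//.
  by apply: eq_integral => x _; exact: (congr1 (@^~ x) (funepos_comp f -%R)).
rewrite -(ge0_integral_opp (measurable_funeneg mf))//.
by apply: eq_integral => x _; exact: (congr1 (@^~ x) (funeneg_comp f -%R)).
Qed.

Lemma integral_reflect (t : R) (f : R -> \bar R) : measurable_fun [set: R] f ->
  \int[mu]_x f (t - x)%R = \int[mu]_x f x.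
Proof.
move=> mf; rewrite -(integral_shift t mf).
rewrite -(@integral_opp (fun x => f (x + t)%R)).
  by apply: eq_integral => x _; rewrite addrC.
apply: (measurableT_comp mf).
exact: measurable_funD.
Qed.

End Integrals.

(** * Powers on the positive half-line *)

Section PositivePower.
Context {R : realType}.
Notation mu := (@lebesgue_measure R).

(** The truncated power with exponent a - 1 instead of a: with this indexing the
    parameters add up under convolution. *)
Definition pospow (a t : R) : R := if 0 < t then t `^ (a - 1) else 0.

Lemma pospow_gt0 a t : 0 < t -> pospow a t = t `^ (a - 1).
Proof. by rewrite /pospow => ->. Qed.

Lemma pospow_le0 a t : t <= 0 -> pospow a t = 0.
Proof. by rewrite /pospow ltNge => ->. Qed.

Lemma pospow_ge0 a t : 0 <= pospow a t.
Proof. by rewrite /pospow; case: ifP => // _; exact: powR_ge0. Qed.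

Lemma pospow_patch a :
  pospow a = (fun t => t `^ (a - 1)) \_ [set t | 0 < t].
Proof.
apply/funext => t; rewrite patchE /pospow.
by case: ifPn => t0; [rewrite mem_set|rewrite memNset//; exact/negP].
Qed.

Lemma measurable_pospow a : measurable_fun [set: R] (pospow a).
Proof.
rewrite pospow_patch; apply/(measurable_restrictT _ _).1; last first.
  by apply: measurable_funTS; exact: measurable_powR.
have -> : [set t : R | 0 < t] = `]0, +oo[%classic.
  by apply/seteqP; split => x /=; rewrite in_itv/= andbT.
exact: measurable_itv.
Qed.

(** The integrand is unbounded at 0 when a < 1, so the fundamental theorem of
    calculus is applied on [1/(n+2), 1], where the integral is at most 1/a, and
    n tends to infinity. *)
Lemma integral_powR_near0 (a : R) : 0 < a ->
  (\int[mu]_(t in `]0%R, 1%R]) (t `^ (a - 1))%:E < +oo)%E.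
Proof.
move=> a0.
(* n + 2 makes the left endpoint smaller than 1 from n = 0 on. *)
pose F n : set (measurableTypeR R) := `[(n.+2%:R^-1 : R), 1]%classic.
have lt1 n : (n.+2%:R^-1 : R) < 1 by rewrite invf_lt1// ltr1n.
have UF : \bigcup_n F n = `]0%R, 1%R]%classic.
  apply/seteqP; split => [x [n _]|x].
    rewrite /F/= !in_itv/= => /andP[h ->]; rewrite andbT.
    by apply: lt_le_trans h; rewrite invr_gt0.
  rewrite /= in_itv/= => /andP[x0 x1].
  have [n nx] : exists n : nat, x^-1 < n%:R.
    by exists (Num.truncn x^-1).+1; rewrite truncnS_gt.
  exists n => //; rewrite /F/= in_itv/= x1 andbT.
  rewrite -[leRHS]invrK lef_pV2 ?posrE ?invr_gt0//.
  by apply/ltW/(lt_trans nx); rewrite ltr_nat.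
have mF n : measurable (F n) by exact: measurable_itv.
have mf : measurable_fun [set: R] (fun t : R => (t `^ (a - 1))%:E).
  by apply/measurable_EFinP; exact: measurable_powR.
have ndF : nondecreasing_seq F.
  move=> m n mn; apply/subsetPset => x; rewrite /F/= !in_itv/= => /andP[h ->].
  rewrite andbT; apply: le_trans h.
  by rewrite lef_pV2 ?posrE// ler_nat.
have := @ge0_nondecreasing_set_cvg_integral _ _ _ F _ mu ndF mF
  (fun n => measurable_funTS mf) (fun n x _ => powR_ge0 _ _).
rewrite UF => cvF; apply: (@le_lt_trans _ _ (a^-1)%:E); last by rewrite ltry.
rewrite -(cvg_lim _ cvF)//; apply: lime_le.
  by apply/cvg_ex; eexists; exact: cvF.
near=> n.
have n0 : 0 < (n.+2%:R^-1 : R) by rewrite invr_gt0.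
have dG (x : R) : 0 < x ->
    is_derive x 1 (fun x => a^-1 * x `^ a) (x `^ (a - 1)).
  move=> x0.
  have h := is_derive1_powR a x0.
  apply: is_derive_eq; rewrite /GRing.scale/=.
  by rewrite mulrA mulVf ?gt_eqF// mul1r.
have cG (x : R) : 0 < x -> {for x, continuous (fun x => a^-1 * x `^ a)}.
  move=> x0; apply: differentiable_continuous.
  by apply/derivable1_diffP; have [] := dG x x0.
rewrite (@continuous_FTC2 _ (fun x => x `^ (a - 1)) (fun x => a^-1 * x `^ a))//.
- rewrite -EFinB lee_fin powR1 mulr1 gerBl// mulr_ge0 ?powR_ge0//.
  by rewrite invr_ge0 ltW.
- apply: derivable_within_continuous => x; rewrite in_itv/= => /andP[x0 _].
  by apply: derivable_powR; rewrite in_itv/= (lt_le_trans n0 x0).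
- split.
  + move=> x; rewrite in_itv/= => /andP[x0 _].
    by have [] := dG x (lt_trans n0 x0).
  + apply: cvg_at_right_filter.
    exact: cG.
  + apply: cvg_at_left_filter.
    exact: cG.
- move=> x; rewrite in_itv/= => /andP[x0 _].
  by rewrite derive1E; have [_ ->] := dG x (lt_trans n0 x0).
Unshelve. all: by end_near. Qed.

End PositivePower.

(** * Euler's Gamma function *)

Section GammaFunction.
Context {R : realType}.
Notation mu := (@lebesgue_measure R).

Definition Gamma_integrand (a t : R) : R := pospow a t * expR (- t).

Lemma measurable_Gamma_integrand a : measurable_fun [set: R] (Gamma_integrand a).
Proof.
apply: measurable_funM; first exact: measurable_pospow.
by apply: (measurableT_comp (@measurable_expR R)); exact: measurable_funN.
Qed.

Lemma Gamma_integrand_ge0 a t : 0 <= Gamma_integrand a t.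
Proof. by rewrite mulr_ge0 ?pospow_ge0 ?expR_ge0. Qed.

Lemma GammaE a : Gamma a = \int[mu]_t Gamma_integrand a t.
Proof.
rewrite /Gamma Rintegral_mkcond; apply: eq_Rintegral => t _.
rewrite patchE /Gamma_integrand /pospow.
case: ifPn; rewrite ?inE ?notin_setE /= in_itv/= andbT; first by move=> ->.
by move/negP/negbTE => ->; rewrite mul0r.
Qed.

(** Half of the exponential decay absorbs the power, because exp(t/2) exceeds
    every Taylor monomial (t/2)^(n+1) / (n+1)!. *)
Lemma powR_expR_bound (a : R) : exists2 K, 0 <= K &
  forall t, 1 <= t -> t `^ (a - 1) * expR (- t) <= K * expR (- (t / 2)).
Proof.
have [n an] : exists n : nat, a - 1 <= n.+1%:R.
  by exists (Num.truncn (a - 1)); apply: ltW; rewrite truncnS_gt.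
pose K : R := 2 ^+ n.+1 * n.+1`!%:R.
have K0 : 0 <= K by rewrite mulr_ge0 ?exprn_ge0.
exists K => // t t1.
have t0 : 0 <= t by rewrite (le_trans _ t1).
have -> : expR (- t) = expR (- (t / 2)) * expR (- (t / 2)).
  by rewrite -expRD; congr expR; field.
rewrite mulrA ler_wpM2r ?expR_ge0//.
rewrite expRN ler_pdivrMr ?expR_gt0//.
apply: (@le_trans _ _ (t `^ n.+1%:R)); first by rewrite ler_powR.
rewrite powR_mulrn//.
have := expR_ge1Dxn n (divr_ge0 t0 (ler0n _ 2)).
move=> h; have {}h : (t / 2) ^+ n.+1 / n.+1`!%:R <= expR (t / 2).
  by apply: le_trans h; rewrite lerDr.
have -> : t ^+ n.+1 = K * ((t / 2) ^+ n.+1 / n.+1`!%:R).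
  rewrite /K expr_div_n; field.
  by rewrite expf_neq0//= pnatr_eq0 -lt0n fact_gt0.
by rewrite ler_wpM2l.
Qed.

(** The integrand is dominated by t^(a-1) on ]0, 1] and by an exponential density
    of rate 1/2 beyond 1. *)
Lemma integrable_Gamma (a : R) : 0 < a ->
  mu.-integrable setT (EFin \o Gamma_integrand a).
Proof.
move=> a0; have [K K0 HK] := powR_expR_bound a.
pose p := fun t : R => t `^ (a - 1).
have ip : mu.-integrable setT (EFin \o (p \_ `]0, 1])).
  rewrite -restrict_EFin; apply/(integrable_mkcond _ _).1.
    exact: measurable_itv.
  apply/integrableP; split.
    by apply/measurable_EFinP/measurable_funTS; exact: measurable_powR.
  under eq_integral do rewrite /= ger0_norm ?powR_ge0//.
  exact: integral_powR_near0.
have ie : mu.-integrable setT (fun x => (K * 2)%:E * (exponential_pdf (2^-1 : R) x)%:E)%E.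
  by apply: integrableZl => //; apply: integrable_exponential_pdf; rewrite ?invr_gt0.
apply: le_integrable (integrableD measurableT ip ie) => //.
  by apply/measurable_EFinP; exact: measurable_Gamma_integrand.
move=> t _ /=; rewrite lee_fin.
rewrite ger0_norm ?Gamma_integrand_ge0//.
have e0 x : 0 <= exponential_pdf (2^-1 : R) x by apply: exponential_pdf_ge0; rewrite invr_ge0.
have p0 x : 0 <= (p \_ `]0, 1]) x by apply: restrict_ge0 => ? ?; exact: powR_ge0.
apply: le_trans (ler_norm _).
rewrite /Gamma_integrand; have [t0|t0] := leP t 0.
  by rewrite pospow_le0// mul0r addr_ge0// !mulr_ge0.
rewrite pospow_gt0//; have [t1|t1] := leP t 1.
  rewrite (@le_trans _ _ ((p \_ `]0, 1]) t))//.
    rewrite patchE mem_set/= ?in_itv/= ?t0// ler_piMr ?powR_ge0//.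
    by rewrite expR_le1 oppr_le0 ltW.
  by rewrite lerDl !mulr_ge0.
apply: (le_trans (HK t (ltW t1))).
rewrite ler_wpDl// exponential_pdfE; last exact: ltW.
by rewrite mulNr [_ * t]mulrC mulrA -[K * 2 * _]mulrA divff ?mulr1.
Qed.

Lemma EFin_Gamma (a : R) : 0 < a ->
  ((Gamma a)%:E = \int[mu]_t (Gamma_integrand a t)%:E)%E.
Proof.
move=> a0; rewrite GammaE /Rintegral fineK//.
exact: (integrable_fin_num measurableT (integrable_Gamma a0)).
Qed.

(** A window of length 1 suffices for positivity as well as for superexponential
    growth. *)
Lemma Gamma_ge (a c M : R) : 0 < a -> 0 <= c ->
  (forall t, M <= t <= M + 1 -> c <= Gamma_integrand a t) -> c <= Gamma a.
Proof.
move=> a0 c0 h; rewrite -lee_fin EFin_Gamma//.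
pose I : set (measurableTypeR R) := `[M, M + 1]%classic.
have mI : measurable I by exact: measurable_itv.
apply: (@le_trans _ _ (\int[mu]_(t in I) c%:E)%E).
  rewrite integral_cst// /I/= lebesgue_measure_itv/= lte_fin ltrDl ltr01.
  by rewrite -EFinB addrAC subrr add0r mule1.
rewrite integral_mkcond; apply: ge0_le_integral => //.
- by move=> x _; apply: erestrict_ge0.
- by apply/(measurable_restrictT _ _).1.
- by apply/measurable_EFinP; exact: measurable_Gamma_integrand.
- move=> x _; rewrite restrict_EFin/= lee_fin patchE.
  case: ifPn => [|_]; last exact: Gamma_integrand_ge0.
  by rewrite inE /I/= in_itv/=; exact: h.
Qed.

(** As M is arbitrary, Gamma(y) grows faster than M^y for every M: this is what
    makes the Mittag-Leffler series converge everywhere. *)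
Lemma Gamma_ge_powR (y M : R) : 0 < y -> 0 < M ->
  M `^ y * (expR (- (M + 1)) / (M + 1)) <= Gamma y.
Proof.
move=> y0 M0; have M10 : 0 < M + 1 by rewrite addr_gt0.
apply: (@Gamma_ge y _ M) => // [|t /andP[Mt tM]].
  by rewrite mulr_ge0 ?powR_ge0// divr_ge0 ?expR_ge0// ltW.
have t0 : 0 < t by rewrite (lt_le_trans _ Mt).
rewrite /Gamma_integrand pospow_gt0// mulrCA mulrC.
have M0' := ltW M0; have M10' := ltW M10; have t0' := ltW t0.
apply: ler_pM; rewrite ?expR_ge0 ?mulr_ge0 ?powR_ge0 ?invr_ge0//; last first.
  by rewrite ler_expR lerN2.
rewrite powRB; last by rewrite (gt_eqF t0) implybT.
rewrite powRr1//.
by rewrite ler_pM ?powR_ge0 ?invr_ge0 ?lef_pV2 ?ge0_ler_powR// ltW.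
Qed.

Lemma Gamma_gt0 (a : R) : 0 < a -> 0 < Gamma a.
Proof.
move=> a0; apply: lt_le_trans (Gamma_ge_powR a0 ltr01).
by rewrite mulr_gt0 ?powR_gt0// divr_gt0 ?expR_gt0.
Qed.

Lemma Gamma1 : Gamma 1 = 1 :> R.
Proof.
rewrite -[RHS](congr1 fine (@integral_exponential_pdf R 1 ltr01)).
rewrite /Gamma /Rintegral; congr fine.
rewrite integral_itv_obnd_cbnd; last first.
  apply/measurable_EFinP/measurable_funTS.
  apply: measurable_funM; first exact: measurable_powR.
  by apply: (measurableT_comp (@measurable_expR R)); exact: measurable_funN.
rewrite integral_mkcond; apply: eq_integral => x _.
rewrite restrict_EFin/=; congr EFin; rewrite /exponential_pdf !patchE.
by case: ifP => // _; rewrite subrr powRr0 !mul1r mulN1r.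
Qed.

End GammaFunction.

(** * Riemann-Liouville kernels and the beta integral *)

Section RiemannLiouvilleKernel.
Context {R : realType}.
Notation mu := (@lebesgue_measure R).

Definition rlker (a t : R) : R := pospow a t / Gamma a.

Lemma rlker_ge0 a t : 0 < a -> 0 <= rlker a t.
Proof. by move=> a0; rewrite mulr_ge0 ?pospow_ge0// invr_ge0 ltW// Gamma_gt0. Qed.

Lemma rlker_le0 a t : t <= 0 -> rlker a t = 0.
Proof. by move=> t0; rewrite /rlker pospow_le0// mul0r. Qed.

Lemma measurable_rlker a : measurable_fun [set: R] (rlker a).
Proof. by apply: measurable_funM => //; exact: measurable_pospow. Qed.

Lemma measurable_sub_swap (f : R -> R) t : measurable_fun [set: R] f ->
  measurable_fun [set: R] (fun s => f (t - s)).
Proof.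
by move=> mf; apply: (measurableT_comp mf); exact: measurable_funB.
Qed.

Lemma pospow_scale (a c t : R) : 0 < c -> pospow a (c * t) = c `^ (a - 1) * pospow a t.
Proof.
move=> c0; rewrite /pospow pmulr_rgt0//; case: ifPn => [t0|]; last by rewrite mulr0.
by rewrite powRM// ltW.
Qed.

Let beta (a b : R) : \bar R := (\int[mu]_s (pospow a (1 - s) * pospow b s)%:E)%E.

(** Substituting s = x r turns the convolution at x into x^(a+b-1) times its value
    at 1, the beta integral. *)
Let integral_pospow_beta (a b x : R) :
  (\int[mu]_s (pospow a (x - s) * pospow b s)%:E =
   (pospow (a + b) x)%:E * beta a b)%E.
Proof.
have [x0|x0] := leP x 0.
  rewrite (@pospow_le0 _ (a + b))// mul0e integral0_eq// => s _.
  have [s0|s0] := leP s 0; first by rewrite (pospow_le0 _ s0) mulr0.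
  by rewrite (@pospow_le0 _ a) ?mul0r// subr_le0 (le_trans x0 (ltW s0)).
pose f s := (pospow a (x - s) * pospow b s)%:E.
have mf : measurable_fun [set: R] f.
  apply/measurable_EFinP; apply: measurable_funM; last exact: measurable_pospow.
  by apply: measurable_sub_swap; exact: measurable_pospow.
have f0 s : (0 <= f s)%E by rewrite lee_fin mulr_ge0 ?pospow_ge0.
have := ge0_integral_affine 0 x0 mf f0.
have fE s : f (x * s + 0) = ((x `^ (a - 1) * x `^ (b - 1))%:E *
    (pospow a (1 - s) * pospow b s)%:E)%E.
  rewrite /f addr0 -{1}[x]mulr1 -mulrBr !pospow_scale// -EFinM; congr EFin.
  by rewrite mulrACA.
under eq_integral do rewrite fE.
rewrite ge0_integralZl_EFin//; last 3 first.
- by move=> s _; rewrite lee_fin mulr_ge0 ?pospow_ge0.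
- apply/measurable_EFinP; apply: measurable_funM; last exact: measurable_pospow.
  by apply: measurable_sub_swap; exact: measurable_pospow.
- by rewrite mulr_ge0 ?powR_ge0.
move=> E; rewrite -/(f _) -[LHS]mul1e -[1%E](_ : (x%:E * x^-1%:E)%E = _); last first.
  by rewrite -EFinM divff// gt_eqF.
rewrite -muleA -E muleA -EFinM; congr (_%:E * _)%E.
have xn0 : x != 0 by rewrite gt_eqF.
rewrite pospow_gt0// -[X in X * _](powRr1 (ltW x0)) -!powRD ?xn0 ?implybT//.
by congr (_ `^ _); ring.
Qed.

(** Integrate exp(-x) times the convolution of t^(a-1) and t^(b-1) at x.  By
    scaling this is Gamma(a+b) times the beta integral; since
    exp(-x) = exp(-(x-s)) exp(-s), it is also Gamma(a) Gamma(b), by Tonelli's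
    theorem and translation invariance. *)
Let Gamma_beta (a b : R) : 0 < a -> 0 < b ->
  ((Gamma a * Gamma b)%:E = (Gamma (a + b))%:E * beta a b)%E.
Proof.
move=> a0 b0; have ab0 : 0 < a + b by rewrite addr_gt0.
pose F (z : measurableTypeR R * measurableTypeR R) : \bar R :=
  (Gamma_integrand a (z.1 - z.2) * Gamma_integrand b z.2)%:E.
have mF : measurable_fun setT F.
  apply/measurable_EFinP; apply: measurable_funM.
    apply: (measurableT_comp (measurable_Gamma_integrand a)).
    by apply: measurable_funB; [exact: measurable_fst|exact: measurable_snd].
  apply: (measurableT_comp (measurable_Gamma_integrand b)).
  exact: measurable_snd.
have F0 z : (0 <= F z)%E by rewrite lee_fin mulr_ge0 ?Gamma_integrand_ge0.
have := @fubini_tonelli _ _ _ _ _ mu mu F mF F0.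
have -> : (\int[mu]_x \int[mu]_y F (x, y) = (Gamma (a + b))%:E * beta a b)%E.
  rewrite EFin_Gamma// -ge0_integralZr//; last 3 first.
  - by apply/measurable_EFinP; exact: measurable_Gamma_integrand.
  - by move=> x _; rewrite lee_fin Gamma_integrand_ge0.
  - by apply: integral_ge0 => s _; rewrite lee_fin mulr_ge0 ?pospow_ge0.
  apply: eq_integral => x _.
  have FE y : F (x, y) = ((expR (- x))%:E *
      (pospow a (x - y) * pospow b y)%:E)%E.
    rewrite /F /Gamma_integrand/= -EFinM; congr EFin.
    have -> : expR (- x) = expR (- (x - y)) * expR (- y).
      by rewrite -expRD; congr expR; ring.
    by ring.
  under eq_integral do rewrite FE.
  rewrite ge0_integralZl_EFin ?expR_ge0//; last 2 first.
  - by move=> y _; rewrite lee_fin mulr_ge0 ?pospow_ge0.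
  - apply/measurable_EFinP; apply: measurable_funM; last exact: measurable_pospow.
    by apply: measurable_sub_swap; exact: measurable_pospow.
  by rewrite integral_pospow_beta muleA -EFinM mulrC.
move=> ->.
under [RHS]eq_integral => y _.
  under eq_integral do rewrite /F/= mulrC EFinM.
  rewrite ge0_integralZl_EFin ?Gamma_integrand_ge0//; last 2 first.
  - by move=> x _; rewrite lee_fin Gamma_integrand_ge0.
  - apply/measurable_EFinP.
    by apply: (measurableT_comp (measurable_Gamma_integrand a)); exact: measurable_funB.
  rewrite (@integral_shift _ (- y) (fun x => (Gamma_integrand a x)%:E)); last first.
    by apply/measurable_EFinP; exact: measurable_Gamma_integrand.
  rewrite -EFin_Gamma//.
  over.
rewrite ge0_integralZr ?EFin_Gamma//.
- by rewrite EFinM !EFin_Gamma// muleC.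
- by apply/measurable_EFinP; exact: measurable_Gamma_integrand.
- by move=> x _; rewrite lee_fin Gamma_integrand_ge0.
- by rewrite -EFin_Gamma// lee_fin ltW ?Gamma_gt0.
Qed.

(** The semigroup law of fractional integration, on the level of kernels. *)
Lemma integral_rlker (a b t : R) : 0 < a -> 0 < b ->
  (\int[mu]_s (rlker a (t - s) * rlker b s)%:E = (rlker (a + b) t)%:E)%E.
Proof.
move=> a0 b0; have ab0 : 0 < a + b by rewrite addr_gt0.
have E s : (rlker a (t - s) * rlker b s)%:E = (((Gamma a * Gamma b)^-1)%:E *
  (pospow a (t - s) * pospow b s)%:E)%E.
  by rewrite -EFinM; congr EFin; rewrite /rlker invfM mulrACA mulrC.
under eq_integral do rewrite E.
rewrite ge0_integralZl_EFin//; last 3 first.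
- by move=> y _; rewrite lee_fin mulr_ge0 ?pospow_ge0.
- apply/measurable_EFinP; apply: measurable_funM; last exact: measurable_pospow.
  by apply: measurable_sub_swap; exact: measurable_pospow.
- by rewrite invr_ge0 mulr_ge0// ltW// Gamma_gt0.
rewrite integral_pospow_beta /rlker muleCA [RHS]EFinM; congr (_ * _)%E.
have Gb := Gamma_beta a0 b0.
have Gab := Gamma_gt0 ab0.
have -> : beta a b = ((Gamma (a + b))^-1%:E * ((Gamma (a + b))%:E * beta a b))%E.
  by rewrite muleA -EFinM mulVf ?mul1e// gt_eqF.
rewrite -Gb muleCA -EFinM mulVf ?mulr1//.
by rewrite gt_eqF// mulr_gt0 ?Gamma_gt0.
Qed.

Lemma rlker1 (t : R) : rlker 1 t = (0 < t)%R%:R.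
Proof.
by rewrite /rlker Gamma1 divr1 /pospow subrr powRr0; case: ifP.
Qed.

End RiemannLiouvilleKernel.

(** * The convolution algebra *)

Section Convolution.
Context {R : realType}.
Notation mu := (@lebesgue_measure R).
Implicit Types (f g u : R -> R) (a b c t C D : R).

Definition conv f g t : R := \int[mu]_s (f (t - s) * g s).

(** The bound is required for t <= 1 only, which is stable under convolution: at
    t <= 1 the factors are only evaluated at points <= 1, unless one of them
    vanishes.  It also forces the function to vanish on t <= 0. *)
Definition rl_bounded C a f := forall t, t <= 1 -> `|f t| <= C * rlker a t.

Definition rl_class f := measurable_fun [set: R] f /\
  exists C a, 0 < a /\ rl_bounded C a f.

Lemma rl_bounded_vanish C a f : rl_bounded C a f -> forall t, t <= 0 -> f t = 0.
Proof.
move=> fC t t0; apply/eqP; rewrite -normr_le0.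
by have := fC t (le_trans t0 ler01); rewrite rlker_le0// mulr0.
Qed.

Lemma rl_class_vanish f : rl_class f -> forall t, t <= 0 -> f t = 0.
Proof. by move=> [_ [C [a [_]]]]; exact: rl_bounded_vanish. Qed.

Lemma rl_class_measurable f : rl_class f -> measurable_fun [set: R] f.
Proof. by case. Qed.

Lemma rl_bounded_integrand C D a b f g t : rl_bounded C a f -> rl_bounded D b g ->
  t <= 1 -> forall s, `|f (t - s) * g s| <= C * D * (rlker a (t - s) * rlker b s).
Proof.
move=> fC gD t1 s; have [s0|s0] := leP s 0.
  by rewrite (rl_bounded_vanish gD s0) (rlker_le0 _ s0) !mulr0 normr0.
have [ts|ts] := leP (t - s) 0.
  by rewrite (rl_bounded_vanish fC ts) (rlker_le0 _ ts) !mul0r mulr0 normr0.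
rewrite normrM mulrACA ler_pM// ?fC ?gD//.
  by rewrite lerBlDr (le_trans t1)// lerDl ltW.
by move: ts; rewrite subr_gt0 => /ltW/le_trans; exact.
Qed.

Lemma measurable_conv_integrand f g t : measurable_fun [set: R] f ->
  measurable_fun [set: R] g -> measurable_fun [set: R] (fun s => f (t - s) * g s).
Proof.
by move=> mf mg; apply: measurable_funM => //; exact: measurable_sub_swap.
Qed.

Lemma integrable_rlker_conv a b t : 0 < a -> 0 < b ->
  mu.-integrable setT (EFin \o (fun s => rlker a (t - s) * rlker b s)).
Proof.
move=> a0 b0; apply/integrableP; split.
  by apply/measurable_EFinP; apply: measurable_conv_integrand; exact: measurable_rlker.
have E s : `|rlker a (t - s) * rlker b s| = rlker a (t - s) * rlker b s.
  by rewrite ger0_norm// mulr_ge0// rlker_ge0.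
under eq_integral do rewrite /= E.
by rewrite integral_rlker// ltry.
Qed.

Lemma integrable_conv f g t : rl_class f -> rl_class g -> t <= 1 ->
  mu.-integrable setT (EFin \o (fun s => f (t - s) * g s)).
Proof.
move=> [mf [C [a [a0 fC]]]] [mg [D [b [b0 gD]]]] t1.
have := integrable_rlker_conv t a0 b0.
move=> /(integrableZl measurableT (C * D)); apply: le_integrable => //.
  by apply/measurable_EFinP; apply: measurable_conv_integrand.
move=> s _ /=; rewrite lee_fin (le_trans _ (ler_norm _))//.
exact: rl_bounded_integrand.
Qed.

Lemma conv_rlker a b t : 0 < a -> 0 < b ->
  conv (rlker a) (rlker b) t = rlker (a + b) t.
Proof. by move=> a0 b0; rewrite /conv /Rintegral integral_rlker. Qed.

(** By Tonelli's theorem the integrals of the positive and negative parts are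
    measurable in t. *)
Lemma measurable_conv f g : measurable_fun [set: R] f ->
  measurable_fun [set: R] g -> measurable_fun [set: R] (conv f g).
Proof.
move=> mf mg.
pose F (z : measurableTypeR R * measurableTypeR R) : \bar R :=
  (f (z.1 - z.2) * g z.2)%:E.
have mF : measurable_fun setT F.
  apply/measurable_EFinP; apply: measurable_funM.
    apply: (measurableT_comp mf).
    by apply: measurable_funB; [exact: measurable_fst|exact: measurable_snd].
  by apply: (measurableT_comp mg); exact: measurable_snd.
have mFp := @measurable_fun_fubini_tonelli_F _ _ _ _ _ mu (F^\+)%E
  (measurable_funepos mF) (funepos_ge0 F).
have mFn := @measurable_fun_fubini_tonelli_F _ _ _ _ _ mu (F^\-)%E
  (measurable_funeneg mF) (funeneg_ge0 F).
rewrite (_ : conv f g = fine \o (fubini_F mu F^\+ \- fubini_F mu F^\-)%E).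
  by apply: measurableT_comp => //; exact: emeasurable_funB.
apply/funext => t; rewrite /conv /Rintegral/= integralE; congr fine.
congr (_ - _)%E; apply: eq_integral => s _.
  exact: (congr1 (@^~ s) (funepos_comp F (pair t))).
exact: (congr1 (@^~ s) (funeneg_comp F (pair t))).
Qed.

(** Convolution multiplies the constants and adds the orders. *)
Lemma conv_bound C D a b f g :
  0 < a -> 0 < b -> measurable_fun [set: R] f -> measurable_fun [set: R] g ->
  rl_bounded C a f -> rl_bounded D b g -> rl_bounded (C * D) (a + b) (conv f g).
Proof.
move=> a0 b0 mf mg fC gD t t1.
have ifg : mu.-integrable setT (EFin \o (fun s => f (t - s) * g s)).
  by apply: integrable_conv => //; split => //; [exists C, a|exists D, b].
have irl := integrable_rlker_conv t a0 b0.
apply: le_trans (le_normr_Rintegral measurableT ifg) _.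
rewrite -conv_rlker// /conv -RintegralZl//; apply: le_Rintegral => //.
- exact: (integrable_norm ifg).
- exact: (integrableZl measurableT _ irl).
- by move=> s _; exact: rl_bounded_integrand.
Qed.

Lemma rl_class_conv f g : rl_class f -> rl_class g -> rl_class (conv f g).
Proof.
move=> [mf [C [a [a0 fC]]]] [mg [D [b [b0 gD]]]]; split.
  exact: measurable_conv.
by exists (C * D), (a + b); split; [exact: addr_gt0|exact: conv_bound].
Qed.

Lemma rl_class_rlker a : 0 < a -> rl_class (rlker a).
Proof.
move=> a0; split; first exact: measurable_rlker.
by exists 1, a; split => // t _; rewrite mul1r ger0_norm// rlker_ge0.
Qed.

(** On t <= 1 a kernel of lower order is larger, up to a constant; so the sum of
    two functions of different orders is again dominated by a single kernel. *)
Lemma rlker_le a b t : 0 < a -> a <= b -> t <= 1 ->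
  rlker b t <= Gamma a / Gamma b * rlker a t.
Proof.
move=> a0 ab t1; have b0 : 0 < b := lt_le_trans a0 ab.
have [t0|t0] := leP t 0; first by rewrite !rlker_le0// mulr0.
have -> : Gamma a / Gamma b * rlker a t = pospow a t / Gamma b.
  by rewrite /rlker; field; rewrite !gt_eqF ?Gamma_gt0.
rewrite ler_pM2r ?invr_gt0 ?Gamma_gt0//.
by rewrite !pospow_gt0// ger_powR ?t0// lerB.
Qed.

Lemma rl_bounded_le C a b f : 0 < a -> a <= b -> rl_bounded C b f ->
  rl_bounded (C * (Gamma a / Gamma b)) a f.
Proof.
move=> a0 ab fC t t1; apply: (le_trans (fC t t1)).
have C0 : 0 <= C.
  have := le_trans (normr_ge0 _) (fC 1 (lexx _)).
  rewrite pmulr_lge0// /rlker pospow_gt0// powR1 mul1r invr_gt0 Gamma_gt0//.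
  exact: lt_le_trans ab.
by rewrite -mulrA ler_wpM2l// rlker_le.
Qed.

Lemma rl_class_lin x y f g : rl_class f -> rl_class g ->
  rl_class (fun t => x * f t + y * g t).
Proof.
move=> [mf [C [a [a0 fC]]]] [mg [D [b [b0 gD]]]]; split.
  by apply: measurable_funD; exact: measurable_funM.
pose c := Num.min a b.
have c0 : 0 < c by rewrite lt_min a0 b0.
have ca : c <= a by rewrite ge_min lexx.
have cb : c <= b by rewrite ge_min lexx orbT.
have fC' := rl_bounded_le c0 ca fC; have gD' := rl_bounded_le c0 cb gD.
exists (`|x| * (C * (Gamma c / Gamma a)) + `|y| * (D * (Gamma c / Gamma b))), c.
split => // t t1; rewrite (le_trans (ler_normD _ _))// !normrM mulrDl.
by rewrite lerD// -mulrA ler_wpM2l// ?fC' ?gD'.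
Qed.

Lemma conv_lin x y f g1 g2 t : rl_class f -> rl_class g1 -> rl_class g2 -> t <= 1 ->
  conv f (fun s => x * g1 s + y * g2 s) t = x * conv f g1 t + y * conv f g2 t.
Proof.
move=> fc gc1 gc2 t1.
have i1 := integrable_conv fc gc1 t1; have i2 := integrable_conv fc gc2 t1.
rewrite /conv -!RintegralZl// -RintegralD//.
- by apply: eq_Rintegral => s _; ring.
- exact: (integrableZl measurableT x i1).
- exact: (integrableZl measurableT y i2).
Qed.

(** For functions vanishing on t <= 0, the convolution at t <= 1 only sees their
    values on ]-oo, 1]. *)
Lemma eq_conv f f' g g' t : rl_class f -> rl_class g ->
  (forall x, x <= 1 -> f x = f' x) -> (forall x, x <= 1 -> g x = g' x) -> t <= 1 ->
  conv f g t = conv f' g' t.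
Proof.
move=> fc gc ff gg t1; apply: eq_Rintegral => s _.
have [s0|s0] := leP s 0.
  by rewrite -gg ?(le_trans s0)// (rl_class_vanish gc s0) !mulr0.
have [ts|ts] := leP (t - s) 0.
  by rewrite -ff ?(le_trans ts)// (rl_class_vanish fc ts) !mul0r.
rewrite ff; last by rewrite lerBlDr (le_trans t1)// lerDl ltW.
by rewrite gg//; move: ts; rewrite subr_gt0 => /ltW/le_trans; exact.
Qed.

Lemma convC f g t : measurable_fun [set: R] f -> measurable_fun [set: R] g ->
  conv f g t = conv g f t.
Proof.
move=> mf mg; rewrite /conv /Rintegral; congr fine.
rewrite -[LHS](integral_reflect t); last first.
  by apply/measurable_EFinP; exact: measurable_conv_integrand.
by apply: eq_integral => s _; rewrite subKr mulrC.
Qed.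

(** Fubini's theorem for f(t-s) g(s-r) u(r).  Its absolute value is dominated by
    the same expression for three Riemann-Liouville kernels, whose double
    integral is again a Riemann-Liouville kernel, hence finite. *)
Lemma convA f g u t : rl_class f -> rl_class g -> rl_class u -> t <= 1 ->
  conv f (conv g u) t = conv (conv f g) u t.
Proof.
move=> fc gc uc t1.
pose H (z : measurableTypeR R * measurableTypeR R) : \bar R :=
  (f (t - z.1) * (g (z.1 - z.2) * u z.2))%:E.
have mH : measurable_fun setT H.
  apply/measurable_EFinP; apply: measurable_funM.
    apply: (measurableT_comp (rl_class_measurable fc)).
    by apply: measurable_funB => //; exact: measurable_fst.
  apply: measurable_funM.
    apply: (measurableT_comp (rl_class_measurable gc)).
    by apply: measurable_funB; [exact: measurable_fst|exact: measurable_snd].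
  by apply: (measurableT_comp (rl_class_measurable uc)); exact: measurable_snd.
have iH : (mu \x mu)%E.-integrable setT H.
  apply/integrable12ltyP => //.
  have [mf [C [a [a0 fC]]]] := fc; have [mg [D [b [b0 gD]]]] := gc.
  have [m_u [K [c [c0 uK]]]] := uc.
  have bc0 : 0 < b + c by rewrite addr_gt0.
  (* Norms make the constants nonnegative, as the monotonicity of the product
     requires. *)
  have C0 : 0 <= `|C| * `|D * K| by rewrite mulr_ge0.
  apply: (@le_lt_trans _ _ (\int[mu]_s ((`|C| * `|D * K|)%:E *
      (rlker a (t - s) * rlker (b + c) s)%:E))%E).
    apply: ge0_le_integral => //.
    - by move=> s _; exact: integral_ge0.
    - by apply: (measurable_fun_fubini_tonelli_F (abse \o H)) => //=;
        exact: measurableT_comp.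
    - apply/measurable_EFinP/measurable_funM => //.
      by apply: measurable_conv_integrand; exact: measurable_rlker.
    move=> s _.
    apply: (@le_trans _ _ (\int[mu]_r ((`|C| * `|D * K| * rlker a (t - s))%:E *
      (rlker b (s - r) * rlker c r)%:E))%E).
      apply: ge0_le_integral => //.
      - by apply: measurableT_comp => //; exact: (measurable_fun_pair2 _ mH).
      - apply/measurable_EFinP/measurable_funM => //.
        by apply: measurable_conv_integrand; exact: measurable_rlker.
      move=> r _; rewrite /H/= lee_fin.
      have [ts|ts] := leP (t - s) 0.
        by rewrite (rl_bounded_vanish fC ts) (rlker_le0 _ ts) mulr0 !mul0r normr0.
      have s1 : s <= 1 by move: ts; rewrite subr_gt0 => /ltW/le_trans; exact.
      have ts1 : t - s <= 1 \/ s <= 0.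
        have [|s0] := leP s 0; first by right.
        by left; rewrite lerBlDr (le_trans t1)// lerDl ltW.
      case: ts1 => [ts1|s0]; last first.
        have -> : g (s - r) * u r = 0.
          have [r0|r0] := leP r 0; first by rewrite (rl_bounded_vanish uK r0) mulr0.
          by rewrite (rl_bounded_vanish gD) ?mul0r// subr_le0 (le_trans s0 (ltW r0)).
        by rewrite mulr0 normr0; apply: mulr_ge0; apply: mulr_ge0; rewrite ?rlker_ge0.
      rewrite normrM.
      rewrite [leRHS](_ : _ = `|C| * rlker a (t - s) *
        (`|D * K| * (rlker b (s - r) * rlker c r))); last by ring.
      apply: ler_pM => //.
        apply: (le_trans (fC _ ts1)).
        by rewrite ler_wpM2r ?rlker_ge0// ler_norm.
      apply: (le_trans (rl_bounded_integrand gD uK s1 r)).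
      by apply: ler_wpM2r; [rewrite mulr_ge0 ?rlker_ge0|exact: ler_norm].
    rewrite ge0_integralZl_EFin//; last 3 first.
    - by move=> r _; rewrite lee_fin mulr_ge0 ?rlker_ge0.
    - apply/measurable_EFinP.
      by apply: measurable_conv_integrand; exact: measurable_rlker.
    - by rewrite mulr_ge0// rlker_ge0.
    by rewrite integral_rlker// -!EFinM lee_fin !mulrA lexx.
  rewrite ge0_integralZl_EFin//; last 2 first.
  - by move=> r _; rewrite lee_fin mulr_ge0 ?rlker_ge0.
  - apply/measurable_EFinP.
    by apply: measurable_conv_integrand; exact: measurable_rlker.
  by rewrite integral_rlker// -!EFinM ltry.
(* The inner integrals are convolutions only where they are evaluated at a point
   <= 1; elsewhere the outer factor vanishes. *)
have FH := Fubini iH.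
rewrite /conv /Rintegral; congr fine.
transitivity (\int[mu]_s \int[mu]_r H (s, r))%E.
  apply: eq_integral => s _; rewrite /H/=.
  have [ts|ts] := leP (t - s) 0.
    rewrite (rl_class_vanish fc ts) mul0r.
    by rewrite integral0_eq// => r _; rewrite mul0r.
  have s1 : s <= 1 by move: ts; rewrite subr_gt0 => /ltW/le_trans; exact.
  have igu := integrable_conv gc uc s1.
  under [RHS]eq_integral do rewrite EFinM.
  rewrite (integralZl measurableT igu) EFinM fineK//.
  exact: (integrable_fin_num measurableT igu).
rewrite FH; apply: eq_integral => r _; rewrite /H/=.
have [r0|r0] := leP r 0.
  rewrite (rl_class_vanish uc r0) mulr0.
  by rewrite integral0_eq// => s _; rewrite !mulr0.
have tr1 : t - r <= 1 by rewrite lerBlDr (le_trans t1)// lerDl ltW.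
have ifg := integrable_conv fc gc tr1.
rewrite -(@integral_shift _ r (fun s => (f (t - s) * (g (s - r) * u r))%:E)); last first.
  apply/measurable_EFinP/measurable_funM.
    exact: (measurable_sub_swap _ (rl_class_measurable fc)).
  apply: measurable_funM => //.
  by apply: (measurableT_comp (rl_class_measurable gc)); exact: measurable_funB.
under eq_integral => s _.
  rewrite addrK (_ : t - (s + r) = t - r - s); last by ring.
  rewrite mulrA mulrC EFinM.
  over.
rewrite (integralZl measurableT ifg) EFinM muleC fineK//.
exact: (integrable_fin_num measurableT ifg).
Qed.

End Convolution.

(** * The Mittag-Leffler kernel and its resolvent equation *)

Section MittagLefflerKernel.
Context {R : realType}.
Variables (alpha lam : R).
Hypotheses (alpha_gt0 : 0 < alpha) (lam_gt0 : 0 < lam).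

Let index_gt0 n : 0 < alpha * n%:R + alpha.
Proof. by rewrite ltr_wpDl// mulr_ge0// ltW. Qed.

(** With M^alpha = 2x, the lower bound Gamma(y) >= K M^y bounds the n-th term by a
    multiple of 2^(-n). *)
Lemma ML_summable (x : R) : 0 < x ->
  cvgn (series (fun n => x ^+ n / Gamma (alpha * n%:R + alpha))).
Proof.
move=> x0; pose M : R := (2 * x) `^ (alpha^-1).
have x2 : 0 < 2 * x by rewrite mulr_gt0.
have M0 : 0 < M by rewrite powR_gt0.
have Malpha : M `^ alpha = 2 * x.
  by rewrite /M -powRrM mulVf ?gt_eqF// powRr1// ltW.
pose K : R := expR (- (M + 1)) / (M + 1).
have K0 : 0 < K by rewrite divr_gt0 ?expR_gt0// addr_gt0.
have G0 n : 0 < Gamma (alpha * n%:R + alpha) by exact: Gamma_gt0.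
apply: (@series_le_cvg _ _ (geometric ((2 * x * K)^-1) (2^-1))).
- by move=> n; rewrite divr_ge0 ?exprn_ge0// ltW.
- by move=> n; rewrite geometric_ge0// invr_ge0 (ltW (mulr_gt0 x2 K0)).
- move=> n /=; rewrite ler_pdivrMr//.
  have := Gamma_ge_powR (index_gt0 n) M0.
  rewrite powRD; last by rewrite (gt_eqF M0) implybT.
  rewrite powRrM Malpha powR_mulrn ?(ltW x2)// -/K exprMn => h.
  have c0 : 0 <= (2 * x * K)^-1 * 2^-1 ^+ n.
    by rewrite mulr_ge0 ?exprn_ge0// invr_ge0 (ltW (mulr_gt0 x2 K0)).
  apply: le_trans (ler_wpM2l c0 h); rewrite le_eqVlt; apply/orP; left.
  apply/eqP; rewrite exprVn; field.
  by rewrite !gt_eqF ?exprn_gt0.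
- apply: is_cvg_geometric_series.
  by rewrite ger0_norm ?invr_ge0// invf_lt1// ltr1n.
Qed.

Lemma ML_cvg (z : R) :
  cvgn (series (fun n => z ^+ n / Gamma (alpha * n%:R + alpha))).
Proof.
apply: (@normed_cvg R R^o).
have z0 : 0 < `|z| + 1 by rewrite ltr_wpDl.
apply: (series_le_cvg _ _ _ (ML_summable z0)) => [n|n|n] /=.
- exact: normr_ge0.
- by rewrite divr_ge0 ?exprn_ge0 ?(ltW z0) ?(ltW (Gamma_gt0 (index_gt0 n))).
rewrite normrM normrX normfV (gtr0_norm (Gamma_gt0 (index_gt0 n))).
rewrite ler_wpM2r ?invr_ge0 ?(ltW (Gamma_gt0 (index_gt0 n)))//.
by rewrite lerXn2r ?nnegrE ?(ltW z0)// lerDl.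
Qed.

Definition ml_kernel t : R :=
  pospow alpha t * mittag_leffler alpha alpha (- (lam * t `^ alpha)).

(** Multiplying the n-th term of the Mittag-Leffler series by t^(alpha-1) gives a
    Riemann-Liouville kernel of order alpha n + alpha. *)
Definition ml_partial N t : R :=
  \sum_(n < N) (- lam) ^+ n * rlker (alpha * n%:R + alpha) t.

(** By [rlker_le], these terms dominate those of the kernel series relatively to
    rlker alpha, uniformly in t <= 1. *)
Let ml_bound_series : R^nat := series (fun n =>
  Gamma alpha * (lam ^+ n / Gamma (alpha * n%:R + alpha))).

Let ml_bound_cvg : cvgn ml_bound_series.
Proof. by apply: is_cvg_seriesZ; exact: ML_summable. Qed.

Definition ml_tail N : R := limn ml_bound_series - ml_bound_series N.

Lemma ml_tail_cvg0 : ml_tail @ \oo --> (0 : R).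
Proof.
rewrite -(subrr (limn ml_bound_series)).
by apply: cvgB; [exact: cvg_cst|exact: ml_bound_cvg].
Qed.

Lemma ml_partial_cvg t : ml_partial ^~ t @ \oo --> ml_kernel t.
Proof.
have [t0|t0] := leP t 0.
  rewrite /ml_kernel pospow_le0// mul0r.
  rewrite (_ : ml_partial ^~ t = cst 0); first exact: cvg_cst.
  apply/funext => N; rewrite /ml_partial big1// => n _.
  by rewrite rlker_le0// mulr0.
have E : ml_partial ^~ t = (fun N => pospow alpha t *
  series (fun n => (- (lam * t `^ alpha)) ^+ n / Gamma (alpha * n%:R + alpha)) N).
  apply/funext => N; rewrite /ml_partial /series/= big_mkord big_distrr/=.
  apply: eq_bigr => n _; rewrite /rlker !pospow_gt0//.
  have -> : alpha * n%:R + alpha - 1 = alpha * n%:R + (alpha - 1) by ring.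
  rewrite (@powRD _ t (alpha * n%:R)); last by rewrite (gt_eqF t0) implybT.
  rewrite powRrM powR_mulrn ?powR_ge0// -mulNr exprMn.
  by rewrite !mulrA; congr (_ / _); ring.
rewrite E; apply: cvgM; [exact: cvg_cst|exact: ML_cvg].
Qed.

(** The series converges uniformly on ]-oo, 1] relatively to rlker alpha, which is
    what allows the limit to be taken under the convolution below. *)
Lemma ml_kernel_approx N t : t <= 1 ->
  `|ml_kernel t - ml_partial N t| <= ml_tail N * rlker alpha t.
Proof.
move=> t1.
have cvL : (fun m => `|ml_partial m t - ml_partial N t|) @ \oo -->
    `|ml_kernel t - ml_partial N t|.
  by apply: cvg_norm; apply: cvgB; [exact: ml_partial_cvg|exact: cvg_cst].
have cvR : (fun m => (ml_bound_series m - ml_bound_series N) * rlker alpha t) @ \oo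
    --> ml_tail N * rlker alpha t.
  apply: cvgM; last exact: cvg_cst.
  by apply: cvgB; [exact: ml_bound_cvg|exact: cvg_cst].
rewrite -(cvg_lim _ cvL)// -(cvg_lim _ cvR)//.
apply: ler_lim; [exact: cvgP cvL|exact: cvgP cvR|].
near=> m; have Nm : (N <= m)%N by near: m; exact: nbhs_infty_ge.
have sumB (F : R^nat) : \sum_(n < m) F n - \sum_(n < N) F n = \sum_(N <= n < m) F n.
  rewrite -!(big_mkord predT) (@big_cat_nat _ _ _ N 0 m)//=.
  by rewrite addrAC subrr add0r.
rewrite /ml_partial (sumB (fun n => (- lam) ^+ n * rlker (alpha * n%:R + alpha) t)).
rewrite /ml_bound_series /series/= !big_mkord
  (sumB (fun n => Gamma alpha * (lam ^+ n / Gamma (alpha * n%:R + alpha)))).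
rewrite big_distrl/=; apply: (le_trans (ler_norm_sum _ _ _)).
apply: ler_sum => n _.
rewrite normrM normrX normrN (gtr0_norm lam_gt0) ger0_norm ?rlker_ge0//.
rewrite [leRHS](_ : _ = lam ^+ n * (Gamma alpha / Gamma (alpha * n%:R + alpha) *
  rlker alpha t)); last by ring.
apply: ler_wpM2l; first by rewrite exprn_ge0// ltW.
by apply: rlker_le => //; rewrite lerDr mulr_ge0// ltW.
Unshelve. all: by end_near. Qed.

Lemma rl_class_ml_partial N : rl_class (ml_partial N).
Proof.
elim: N => [|N IH].
  split.
    rewrite (_ : ml_partial 0 = cst 0)//.
    by apply/funext => t; rewrite /ml_partial big_ord0.
  exists 0, 1; split => // t _.
  by rewrite /ml_partial big_ord0 normr0 mul0r.
rewrite (_ : ml_partial N.+1 = fun t => 1 * ml_partial N t +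
  (- lam) ^+ N * rlker (alpha * N%:R + alpha) t).
  by apply: rl_class_lin => //; exact: rl_class_rlker.
by apply/funext => t; rewrite /ml_partial big_ord_recr/= mul1r.
Qed.

Lemma rl_class_ml_kernel : rl_class ml_kernel.
Proof.
split.
  apply: (@measurable_fun_cvg _ _ _ _ ml_partial).
    by move=> N; have [] := rl_class_ml_partial N.
  by move=> t _; exact: ml_partial_cvg.
exists (ml_tail 0), alpha; split => // t t1.
by have := ml_kernel_approx 0 t1; rewrite /ml_partial big_ord0 subr0.
Qed.

(** Convolution with rlker alpha shifts the series by one index. *)
Lemma ml_partial_resolvent N t : t <= 1 ->
  ml_partial N.+1 t = rlker alpha t - lam * conv (rlker alpha) (ml_partial N) t.
Proof.
move=> t1; have ac := rl_class_rlker alpha_gt0.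
elim: N => [|N IH].
  rewrite /ml_partial big_ord1 expr0 mul1r mulr0 add0r.
  rewrite /conv (_ : Rintegral _ _ _ = 0) ?mulr0 ?subr0//.
  under eq_Rintegral do rewrite big_ord0 mulr0.
  by rewrite Rintegral_cst// mul0r.
rewrite {1}/ml_partial big_ord_recr/= -/(ml_partial N.+1 t) IH.
have -> : conv (rlker alpha) (ml_partial N.+1) t = conv (rlker alpha)
    (fun s => 1 * ml_partial N s + (- lam) ^+ N * rlker (alpha * N%:R + alpha) s) t.
  apply: eq_Rintegral => s _; congr (_ * _).
  by rewrite /ml_partial big_ord_recr/= mul1r.
rewrite conv_lin//; [|exact: rl_class_ml_partial|exact: rl_class_rlker].
rewrite conv_rlker// exprS.
have -> : alpha + (alpha * N%:R + alpha) = alpha * N.+1%:R + alpha.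
  by rewrite -natr1; ring.
by ring.
Qed.

(** The limit of the previous identity; by [ml_kernel_approx], the error in the
    convolution is at most ml_tail N times rlker (alpha + alpha) t. *)
Lemma ml_kernel_resolvent t : t <= 1 ->
  ml_kernel t = rlker alpha t - lam * conv (rlker alpha) ml_kernel t.
Proof.
move=> t1; have ac := rl_class_rlker alpha_gt0.
have mc := rl_class_ml_kernel.
have cvconv : (fun N => conv (rlker alpha) (ml_partial N) t) @ \oo -->
    conv (rlker alpha) ml_kernel t.
  apply/cvgrPdist_le => /= e e0.
  have cv0 : (fun N => ml_tail N * rlker (alpha + alpha) t) @ \oo --> (0 : R).
    rewrite -(mul0r (rlker (alpha + alpha) t)).
    by apply: cvgM; [exact: ml_tail_cvg0|exact: cvg_cst].
  move/cvgrPdist_le : cv0 => /(_ e e0); apply: filterS => N.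
  rewrite sub0r normrN => h.
  have -> : conv (rlker alpha) ml_kernel t - conv (rlker alpha) (ml_partial N) t =
      conv (rlker alpha) (fun s => 1 * ml_kernel s + (-1) * ml_partial N s) t.
    rewrite conv_lin//; last exact: rl_class_ml_partial.
    by rewrite mul1r mulN1r.
  apply: le_trans h; apply: le_trans (ler_norm _).
  rewrite -[ml_tail N]mul1r.
  apply: conv_bound => //.
  - by case: ac.
  - by case: (rl_class_lin 1 (-1) mc (rl_class_ml_partial N)).
  - by move=> s _; rewrite mul1r ger0_norm// rlker_ge0.
  - by move=> s s1; rewrite mul1r mulN1r; exact: ml_kernel_approx.
have cv1 : (fun N => ml_partial N.+1 t) @ \oo --> ml_kernel t.
  by have := @ml_partial_cvg t; rewrite -(@cvg_shiftS _ (ml_partial ^~ t)).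
have cv2 : (fun N => ml_partial N.+1 t) @ \oo -->
    rlker alpha t - lam * conv (rlker alpha) ml_kernel t.
  rewrite (_ : (fun N => _) = fun N =>
      rlker alpha t - lam * conv (rlker alpha) (ml_partial N) t).
    apply: cvgB; first exact: cvg_cst.
    by apply: cvgM => //; exact: cvg_cst.
  by apply/funext => N; exact: ml_partial_resolvent.
exact: (cvg_unique _ cv1 cv2).
Qed.

End MittagLefflerKernel.

(** * The Volterra equation *)

Section Volterra.
Context {R : realType}.
Variables (alpha lam : R).
Hypotheses (alpha_gt0 : 0 < alpha) (lam_gt0 : 0 < lam).

Let kappa_class : rl_class (rlker alpha). Proof. exact: rl_class_rlker. Qed.
Let h_class : rl_class (ml_kernel alpha lam). Proof. exact: rl_class_ml_kernel. Qed.

Let ml_kernel_conv (u : R -> R) (t : R) : rl_class u -> t <= 1 ->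
  conv (ml_kernel alpha lam) u t =
  conv (rlker alpha) u t - lam * conv (conv (rlker alpha) (ml_kernel alpha lam)) u t.
Proof.
move=> uc t1; have khc := rl_class_conv kappa_class h_class.
have mk := rl_class_measurable.
rewrite (@eq_conv _ _ (fun s => 1 * rlker alpha s +
  (- lam) * conv (rlker alpha) (ml_kernel alpha lam) s) _ u)//; last first.
  by move=> s s1; rewrite mul1r mulNr; exact: ml_kernel_resolvent.
rewrite convC; [|by apply: mk; exact: rl_class_lin|exact: mk].
rewrite conv_lin// mul1r mulNr.
by congr (_ - _ * _); apply: convC; exact: mk.
Qed.

(** With g = rlker alpha and h the Mittag-Leffler kernel, h = g - lam g * h.
    If e = k g * S - lam g * e, convolving with h gives
    h * e = k h * g * S - lam h * g * e, while the resolvent equation gives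
    h * e = g * e - lam g * h * e; hence g * e = k g * h * S, and
    e = k (g - lam g * h) * S = k h * S.  The converse is the resolvent equation
    convolved with S. *)
Lemma volterra_ml_kernel (k : R) (S e : R -> R) : rl_class S -> rl_class e ->
  (forall t, t <= 1 -> e t = conv (rlker alpha) (fun s => k * S s + (- lam) * e s) t)
  <-> (forall t, t <= 1 -> e t = k * conv (ml_kernel alpha lam) S t).
Proof.
move=> Sc ec; have mk := rl_class_measurable.
split=> He t t1; last first.
  rewrite conv_lin// He// ml_kernel_conv// -convA// (@eq_conv _ _ (rlker alpha) e
    (* The zero summand gives the right-hand side the shape of [conv_lin]. *)
    (fun s => k * conv (ml_kernel alpha lam) S s + 0 * S s))//; last first.
    by move=> s s1; rewrite mul0r addr0 He.
  rewrite conv_lin//; last exact: rl_class_conv.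
  by ring.
have E1 := ml_kernel_conv ec t1.
have E2 : conv (ml_kernel alpha lam) e t =
    k * conv (conv (rlker alpha) (ml_kernel alpha lam)) S t -
    lam * conv (conv (rlker alpha) (ml_kernel alpha lam)) e t.
  rewrite (@eq_conv _ _ (ml_kernel alpha lam) e
    (fun s => k * conv (rlker alpha) S s + (- lam) * conv (rlker alpha) e s))//.
    rewrite conv_lin//; [|exact: rl_class_conv|exact: rl_class_conv].
    rewrite !convA// mulNr.
    have -> : conv (ml_kernel alpha lam) (rlker alpha) =
        conv (rlker alpha) (ml_kernel alpha lam).
      by apply/funext => s; apply: convC; exact: mk.
    by [].
  by move=> s s1; rewrite He// conv_lin.
have E3 : conv (rlker alpha) e t =
    k * conv (conv (rlker alpha) (ml_kernel alpha lam)) S t.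
  by move: E2; rewrite E1 => /addIr.
by rewrite He// conv_lin// E3 ml_kernel_conv//; ring.
Qed.

End Volterra.

(** * Continuity of fractional integrals *)

Section Holder.
Context {R : realType}.
Notation mu := (@lebesgue_measure R).
Variables (a M : R) (u : R -> R).
Hypotheses (a_gt0 : 0 < a) (a_le1 : a <= 1).
Hypotheses (mu_ : measurable_fun [set: R] u) (uM : rl_bounded M 1 u).

Let M_ge0 : 0 <= M.
Proof.
have := le_trans (normr_ge0 _) (uM (lexx 1)).
by rewrite rlker1 ltr01 mulr1.
Qed.

Let u_class : rl_class u.
Proof. by split => //; exists M, 1. Qed.

Lemma rlker_nincr (x y : R) : 0 < x -> x <= y -> rlker a y <= rlker a x.
Proof.
move=> x0 xy; have y0 := lt_le_trans x0 xy.
rewrite /rlker ler_pM2r ?invr_gt0 ?Gamma_gt0// !pospow_gt0//.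
rewrite -[a - 1]opprB !powRN lef_pV2 ?posrE ?powR_gt0//.
by rewrite ge0_ler_powR ?subr_ge0// nnegrE ltW.
Qed.

Lemma rlkerS_ndecr (x y : R) : x <= y -> rlker (a + 1) x <= rlker (a + 1) y.
Proof.
move=> xy; have a1 : 0 < a + 1 by rewrite addr_gt0.
have [x0|x0] := leP x 0; first by rewrite rlker_le0// rlker_ge0.
have y0 := lt_le_trans x0 xy.
rewrite /rlker ler_pM2r ?invr_gt0 ?Gamma_gt0// !pospow_gt0// addrK.
by rewrite ge0_ler_powR ?nnegrE// ltW.
Qed.

(** Since rlker a is nonincreasing on t > 0, the absolute difference of the two
    kernels is rlker a (t - s) - rlker a (t' - s) for s < t, and rlker a (t' - s)
    for s > t.  Integrating gives
    rlker (a+1) t - rlker (a+1) t' + 2 rlker (a+1) (t' - t), where the first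
    difference is nonpositive. *)
Lemma conv_rlker_holder (t t' : R) : t <= t' -> t' <= 1 ->
  `|conv (rlker a) u t' - conv (rlker a) u t| <= 2 * M * rlker (a + 1) (t' - t).
Proof.
move=> tt' t'1; have t1 := le_trans tt' t'1.
have ac := rl_class_rlker a_gt0.
have i1 := integrable_conv ac u_class t1.
have i2 := integrable_conv ac u_class t'1.
have j1 := integrable_rlker_conv t a_gt0 ltr01.
have j2 := integrable_rlker_conv t' a_gt0 ltr01.
have mj : measurable_fun [set: R] (fun s => rlker a (t' - s) * rlker 1 (s - t)).
  apply: measurable_funM; first exact: (measurable_sub_swap _ (@measurable_rlker R a)).
  by apply: (measurableT_comp (@measurable_rlker R 1)); exact: measurable_funB.
have shiftE : (\int[mu]_s (rlker a (t' - s) * rlker 1 (s - t))%:E =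
    (rlker (a + 1) (t' - t))%:E)%E.
  rewrite -(@integral_shift _ t (fun s => (rlker a (t' - s) * rlker 1 (s - t))%:E)).
    rewrite -integral_rlker//; apply: eq_integral => s _.
    by rewrite addrK opprD addrA addrAC.
  exact/measurable_EFinP.
have j3 : mu.-integrable setT
    (EFin \o (fun s => rlker a (t' - s) * rlker 1 (s - t))).
  apply/integrableP; split; first exact/measurable_EFinP.
  have E s : `|rlker a (t' - s) * rlker 1 (s - t)| = rlker a (t' - s) * rlker 1 (s - t).
    by rewrite ger0_norm// mulr_ge0// rlker_ge0.
  under eq_integral do rewrite /= E.
  by rewrite shiftE ltry.
pose F s := rlker a (t' - s) * u s - rlker a (t - s) * u s.
pose G s := M * (rlker a (t - s) * rlker 1 s - rlker a (t' - s) * rlker 1 s +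
  2 * (rlker a (t' - s) * rlker 1 (s - t))).
have iF : mu.-integrable setT (EFin \o F) by exact: (integrableB measurableT i2 i1).
have iB := integrableB measurableT j1 j2.
have i2j := integrableZl measurableT 2 j3.
have iBD := integrableD measurableT iB i2j.
have iG : mu.-integrable setT (EFin \o G) by exact: (integrableZl measurableT M iBD).
have -> : conv (rlker a) u t' - conv (rlker a) u t = \int[mu]_s F s.
  by rewrite /conv -RintegralB.
have intG : \int[mu]_s G s = M * (rlker (a + 1) t - rlker (a + 1) t' +
    2 * rlker (a + 1) (t' - t)).
  rewrite /G RintegralZl// RintegralD// RintegralB// RintegralZl//.
  congr (_ * (_ - _ + _ * _)); rewrite ?/Rintegral ?integral_rlker//.
  by rewrite shiftE.
apply: (@le_trans _ _ (\int[mu]_s G s)); last first.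
  rewrite intG [2 * M]mulrC -mulrA ler_wpM2l// gerDr subr_le0.
  exact: rlkerS_ndecr.
(* The pointwise bound fails at s = t, where both kernels rlker a (t - s) and
   rlker 1 (s - t) vanish. *)
pose D : set (measurableTypeR R) := setT `\ t.
have mD : measurable D by apply: measurableD => //; exact: measurable_set1.
have DT (f : R -> R) : mu.-integrable setT (EFin \o f) ->
    \int[mu]_s f s = \int[mu]_(s in D) f s.
  move=> iff; rewrite /Rintegral /D integral_setD1//.
  by apply: measurable_funTS; exact: measurable_int iff.
have iFD : mu.-integrable D (EFin \o F) by exact: (integrableS measurableT).
have iGD : mu.-integrable D (EFin \o G) by exact: (integrableS measurableT).
rewrite !DT//; apply: le_trans (le_normr_Rintegral mD iFD) _.
apply: le_Rintegral => //; first exact: (integrable_norm iFD).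
move=> s [_ /eqP st]; rewrite /F /G -mulrBl normrM.
have k0 x : 0 <= rlker a x by exact: rlker_ge0.
have [s0|s0] := leP s 0.
  rewrite (rl_class_vanish u_class s0) normr0 mulr0 (rlker_le0 _ s0) !mulr0 subr0 add0r.
  by do 3 apply: mulr_ge0 => //; exact: rlker_ge0.
rewrite !rlker1 s0 !mulr1 [leLHS]mulrC.
have [ts|ts|ts] := ltgtP t s; last by rewrite ts eqxx in st.
  rewrite (@rlker_le0 _ a (t - s)) ?subr_le0 ?(ltW ts)// subr_gt0 ts mulr1 !subr0 sub0r.
  rewrite [X in M * X](_ : _ = rlker a (t' - s)); last by ring.
  rewrite [X in _ * X]ger0_norm//; have [s1|s1] := leP s 1.
    by rewrite ler_wpM2r//; have := uM s1; rewrite rlker1 s0 mulr1.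
  by rewrite rlker_le0 ?mulr0// subr_le0 (le_trans t'1 (ltW s1)).
rewrite subr_gt0 ltNge (ltW ts)/= !mulr0 addr0.
have ts0 : 0 < t - s by rewrite subr_gt0.
rewrite [X in _ * X]distrC [X in _ * X]ger0_norm; last first.
  by rewrite subr_ge0 rlker_nincr// lerB.
rewrite ler_wpM2r//.
  by rewrite subr_ge0 rlker_nincr// lerB.
by have := uM (le_trans (ltW ts) t1); rewrite rlker1 s0 mulr1.
Qed.

Lemma conv_rlker_unif_continuous (e : R) : 0 < e -> exists2 d, 0 < d &
  forall t t', t <= 1 -> t' <= 1 -> `|t - t'| <= d ->
    `|conv (rlker a) u t - conv (rlker a) u t'| <= e.
Proof.
move=> e0; have a1 : 0 < a + 1 by rewrite addr_gt0.
(* rlker (a+1) d = d^a / Gamma(a+1), which equals e / (2M + 1) for d = c^(1/a). *)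
pose c := e / (2 * M + 1) * Gamma (a + 1).
have M1 : 0 < 2 * M + 1 by rewrite ltr_wpDl// mulr_ge0.
have c0 : 0 < c by rewrite mulr_gt0 ?Gamma_gt0// divr_gt0.
exists (c `^ (a^-1)); first by rewrite powR_gt0.
have key t t' : t <= t' -> t' <= 1 -> t' - t <= c `^ (a^-1) ->
    `|conv (rlker a) u t' - conv (rlker a) u t| <= e.
  move=> tt' t'1 d; apply: (le_trans (conv_rlker_holder tt' t'1)).
  have r0 : 0 <= t' - t by rewrite subr_ge0.
  apply: (@le_trans _ _ ((2 * M + 1) * rlker (a + 1) (t' - t))).
    by rewrite ler_wpM2r ?rlker_ge0// lerDl.
  rewrite mulrC -ler_pdivlMr//.
  apply: (le_trans (rlkerS_ndecr d)).
  rewrite /rlker pospow_gt0 ?powR_gt0// addrK -powRrM mulVf ?gt_eqF//.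
  by rewrite powRr1 ?(ltW c0)// /c mulfK// gt_eqF// Gamma_gt0.
move=> t t' t1 t'1; have [tt'|tt'] := leP t t'.
  by rewrite distrC ger0_norm ?subr_ge0// => d; rewrite distrC; exact: key.
by rewrite ger0_norm ?subr_ge0 ?(ltW tt')// => d; apply: key => //; exact: ltW.
Qed.

End Holder.

(** * Functions on the unit interval and the fundamental theorem of calculus *)

Section Extension.
Context {R : realType}.
Notation mu := (@lebesgue_measure R).
Implicit Types (v : R -> R) (x : R).

(** Constant beyond 1, so that a function continuous on [0, 1] becomes continuous
    at 1 from both sides and the two-sided fundamental theorem of calculus
    applies there; zero on x <= 0, as everywhere in the convolution algebra. *)
Definition extend01 v x : R := if 0 < x then v (Num.min x 1) else 0.

Lemma extend01E v x : 0 < x <= 1 -> extend01 v x = v x.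
Proof. by case/andP=> x0 x1; rewrite /extend01 x0 min_l. Qed.

Lemma extend01_le0 v x : x <= 0 -> extend01 v x = 0.
Proof. by rewrite /extend01 ltNge => ->. Qed.

Let clamp x : R := Num.max 0 (Num.min x 1).

Let clamp_itv x : `[0, 1]%classic (clamp x).
Proof.
by rewrite /= in_itv/= /clamp le_max lexx/= ge_max ler01 ge_min lexx orbT.
Qed.

Let clamp_continuous : continuous clamp.
Proof.
move=> x; apply: (@continuous_max R R (cst 0) (fun x => Num.min x 1)).
  exact: cvg_cst.
by apply: (@continuous_min R R id (cst 1)); [exact: cvg_id|exact: cvg_cst].
Qed.

Let continuous_comp_clamp v : {within `[0, 1], continuous v} ->
  continuous (v \o clamp).
Proof.
move=> /subspace_continuousP cv x.
apply: (@cvg_comp _ _ _ clamp v (nbhs x) (within `[0, 1] (nbhs (clamp x)))).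
  move=> P hP; have h : \forall y \near x, `[0, 1]%classic (clamp y) -> P (clamp y).
    exact: (@clamp_continuous x _ hP).
  suff : \forall y \near x, P (clamp y) by [].
  by apply: filterS h => y /(_ (clamp_itv y)).
exact/cv/clamp_itv.
Qed.

Let extend01_clamp v x : 0 < x -> extend01 v x = v (clamp x).
Proof.
move=> x0; rewrite /extend01 x0 /clamp max_r//.
by rewrite le_min ler01 (ltW x0).
Qed.

Lemma extend01_continuous v x : {within `[0, 1], continuous v} -> 0 < x ->
  {for x, continuous (extend01 v)}.
Proof.
move=> cv x0; rewrite /prop_for /continuous_at extend01_clamp//.
apply: cvg_trans (@continuous_comp_clamp v cv x).
apply: near_eq_cvg; near=> y; rewrite /= extend01_clamp//.
by near: y; exact: lt_nbhsr.
Unshelve. all: by end_near. Qed.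

Lemma measurable_extend01 v : {within `[0, 1], continuous v} ->
  measurable_fun [set: R] (extend01 v).
Proof.
move=> cv.
have -> : extend01 v = (fun x => rlker 1 x * v (clamp x)).
  apply/funext => x; rewrite rlker1; have [x0|x0] := ltP 0 x.
    by rewrite mul1r extend01_clamp.
  by rewrite mul0r extend01_le0.
apply: measurable_funM; first exact: measurable_rlker.
exact: (continuous_measurable_fun (continuous_comp_clamp cv)).
Qed.

Lemma extend01_bounded v : {within `[0, 1], continuous v} ->
  exists2 M, 0 <= M & forall x, `|extend01 v x| <= M.
Proof.
move=> cv; have cnv : {within `[0, 1], continuous (fun x => `|v x|)}.
  apply: (@within_continuous_comp R R R `[0, 1] v (fun y => `|y|)) cv => x _.
  exact: norm_continuous.
have [c _ cM] := EVT_max ler01 cnv.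
exists `|v c| => // x; have [x0|x0] := leP x 0.
  by rewrite extend01_le0// normr0.
by rewrite extend01_clamp//; apply: cM; exact: clamp_itv.
Qed.

Lemma rl_bounded_extend01 v M : (forall x, `|extend01 v x| <= M) ->
  rl_bounded M 1 (extend01 v).
Proof.
move=> vM x _; rewrite rlker1; have [x0|x0] := ltP 0 x; first by rewrite mulr1.
by rewrite extend01_le0// normr0 mulr0.
Qed.

Lemma rl_class_extend01 v : {within `[0, 1], continuous v} ->
  rl_class (extend01 v).
Proof.
move=> cv; split; first exact: measurable_extend01.
have [M M0 vM] := extend01_bounded cv.
by exists M, 1; split => //; exact: rl_bounded_extend01.
Qed.

Lemma conv1_extend01 v t : {within `[0, 1], continuous v} ->
  conv (rlker 1) (extend01 v) t = \int[mu]_(s in `]-oo, t]) extend01 v s.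
Proof.
move=> cv; rewrite [RHS]/Rintegral -integral_itv_bndo_bndc; last first.
  by apply/measurable_EFinP/measurable_funTS; exact: measurable_extend01.
rewrite -[RHS]/(Rintegral _ _ _) Rintegral_mkcond; apply: eq_Rintegral => s _.
rewrite patchE rlker1 subr_gt0.
case: ifPn; rewrite ?inE ?notin_setE/= in_itv/=; first by move=> ->; rewrite mul1r.
by move=> /negP/negbTE ->; rewrite mul0r.
Qed.

Lemma integrable_extend01 v U : {within `[0, 1], continuous v} ->
  mu.-integrable `]-oo, U] (EFin \o extend01 v).
Proof.
move=> cv; have [M M0 vM] := extend01_bounded cv.
have := integrable_rlker_conv (U + 1) (@ltr01 R) (@ltr01 R).
move=> /(integrableZl measurableT M)/(integrableS measurableT).
move=> /(_ `]-oo, U]%classic (measurable_itv _) (@subsetT _ _)).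
apply: le_integrable => //.
  by apply/measurable_EFinP/measurable_funTS; exact: measurable_extend01.
move=> s /=; rewrite in_itv/= => sU; rewrite lee_fin.
apply: le_trans (ler_norm _).
have -> : rlker 1 (U + 1 - s) = 1.
  by rewrite rlker1 subr_gt0 (le_lt_trans sU) ?ltrDl.
rewrite mul1r; have [s0|s0] := leP s 0.
  by rewrite extend01_le0// normr0 rlker_le0 ?mulr0.
by rewrite rlker1 s0 mulr1.
Qed.

(** Convolution with rlker 1 is integration from -oo. *)
Lemma is_derive_conv1_extend01 v x : {within `[0, 1], continuous v} -> 0 < x ->
  is_derive x 1 (conv (rlker 1) (extend01 v)) (extend01 v x).
Proof.
move=> cv x0.
have x1 : x < x + 1 by rewrite ltrDl.
have := continuous_FTC1 x1 (integrable_extend01 (x + 1) cv) _ (extend01_continuous cv x0).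
move=> /(_ (ltNyr x)).
have E : conv (rlker 1) (extend01 v) =
    (fun y => \int[mu]_(s in `]-oo, y]) extend01 v s).
  by apply/funext => y; exact: conv1_extend01.
by rewrite E => -[dF FE]; split => //; rewrite -derive1E.
Qed.

Lemma diff_quot_within_is_derive (A : set R) (F : R -> R) x (l : R) :
  is_derive x 1 F l -> diff_quot_within A F x --> l.
Proof.
case=> dF lE.
have cF : (fun h => h^-1 *: ((F \o shift x) (h *: (1 : R)) - F x)) @ 0^' --> l.
  by rewrite -lE; exact: dF.
have sub : (fun y => y - x) @ within A x^' --> (0 : R)^'.
  move=> P [e /= e0 he]; exists e => // y /= yx ynx _ /=; apply: he => /=.
    by rewrite sub0r opprB.
  by rewrite subr_eq0.
have := cvg_comp _ _ sub cF.
apply: cvg_trans; apply: near_eq_cvg; apply: nearW => y /=.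
by rewrite /GRing.scale/= mulr1 subrK mulrC.
Qed.

(** At an interior point of A the restriction to A does not affect the limit. *)
Lemma is_derive_diff_quot_within (A : set R) (F : R -> R) x (l : R) :
  nbhs x A -> diff_quot_within A F x --> l -> is_derive x 1 F l.
Proof.
move=> Ax cF.
have add : (fun h => h + x) @ (0 : R)^' --> within A x^'.
  move=> P /= hP.
  have [e /= e0 he] : nbhs x [set y | y != x -> P y].
    by apply: filterS2 Ax hP => y Ay h yx; exact: h.
  exists e => // h /= hh h0; apply: he => /=.
    by rewrite opprD addrC addrNK -sub0r.
  by rewrite -subr_eq0 addrK.
have := cvg_comp _ _ add cF.
have -> : (fun y => (F y - F x) / (y - x)) \o (fun h => h + x) =
    (fun h => h^-1 *: ((F \o shift x) (h *: (1 : R)) - F x)).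
  by apply/funext => h; rewrite /= /GRing.scale/= mulr1 addrK mulrC.
by move=> c; split; [exact: cvgP c|exact: cvg_lim c].
Qed.
End Extension.

(** * The initial value problem on the unit interval *)

Section UnitInterval.
Context {R : realType}.
Notation mu := (@lebesgue_measure R).
Implicit Types (u v F : R -> R) (x t : R).

Lemma conv_rlker_within_continuous a M u : 0 < a -> a <= 1 ->
  measurable_fun [set: R] u -> rl_bounded M 1 u ->
  {within `[0, 1], continuous (conv (rlker a) u)}.
Proof.
move=> a0 a1 m_u uM; apply/subspace_continuousP => x.
rewrite /= in_itv/= => /andP[_ x1].
apply/cvgrPdist_le => /= e e0.
have [d d0 hd] := conv_rlker_unif_continuous a0 a1 m_u uM e0.
exists d => //= y /= xy; rewrite in_itv/= => /andP[_ y1].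
by apply: hd => //; exact: ltW.
Qed.

Lemma within01_punctured_proper x : 0 < x <= 1 ->
  ProperFilter (within `[0, 1] x^').
Proof.
move=> /andP[x0 x1]; apply: Build_ProperFilter => hP.
have h : \forall y \near x^'-, False.
  near=> y.
  have : y != x -> `[0, 1]%classic y -> False.
    near: y; apply: cvg_within; exact: hP.
  apply; first by rewrite lt_eqF//; near: y; exact: nbhs_left_lt.
  rewrite /= in_itv/=; apply/andP; split.
    by apply: ltW; near: y; exact: nbhs_left_gt.
  by apply: le_trans x1; apply: ltW; near: y; exact: nbhs_left_lt.
by have [] := filter_ex h.
Unshelve. all: by end_near. Qed.

Lemma eq_diff_quot_within (A : set R) F1 F2 x (l : R) : A x ->
  (forall y, A y -> F1 y = F2 y) ->
  diff_quot_within A F1 x --> l -> diff_quot_within A F2 x --> l.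
Proof.
move=> Ax F12; apply: cvg_trans.
apply: near_eq_cvg; apply: (@filterS _ (nbhs x) _ setT); last exact: filterT.
by move=> y _ _ Ay; rewrite /= !F12.
Qed.

Lemma diff_quot_withinZ (A : set R) F x (c l : R) :
  diff_quot_within A F x --> l ->
  diff_quot_within A (fun y => c * F y) x --> c * l.
Proof.
move=> cF; rewrite /diff_quot_within.
rewrite (_ : (fun y => _) = (fun y => c * ((F y - F x) / (y - x)))); last first.
  by apply/funext => y; rewrite -mulrBr mulrA.
by apply: cvgM => //; exact: cvg_cst.
Qed.

(** If the integral of v vanishes identically on [0, 1], so does its derivative v,
    including at 1, where the limit of difference quotients from the left is
    enough. *)
Lemma conv1_extend01_eq0 v : {within `[0, 1], continuous v} ->
  (forall t, 0 <= t <= 1 -> conv (rlker 1) (extend01 v) t = 0) ->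
  forall x, 0 < x <= 1 -> v x = 0.
Proof.
move=> cv F0 x x01; have /andP[x0 x1] := x01.
have pF := within01_punctured_proper x01.
have := @diff_quot_within_is_derive _ `[0, 1] _ _ _ (is_derive_conv1_extend01 cv x0).
rewrite extend01E// => hF.
have h : diff_quot_within `[0, 1] (cst 0 : R -> R) x --> v x.
  apply: eq_diff_quot_within hF => [|y]; rewrite /= in_itv/= ?x1 ?(ltW x0)//.
  exact: F0.
have h0 : diff_quot_within `[0, 1] (cst 0 : R -> R) x --> (0 : R).
  rewrite /diff_quot_within (_ : (fun y => _) = cst 0); first exact: cvg_cst.
  by apply/funext => y; rewrite /= subrr mul0r.
exact: (cvg_unique _ h h0).
Qed.

Lemma within01_constant F : {within `[0, 1], continuous F} ->
  (forall x, 0 < x < 1 -> is_derive x 1 F 0) ->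
  forall t, 0 <= t <= 1 -> F t = F 0.
Proof.
move=> cF dF t /andP[t0 t1].
have [||c _] := @MVT_segment _ F (cst 0) 0 t t0.
- move=> x; rewrite in_itv/= => /andP[x0 xt]; apply: dF.
  by rewrite x0 (lt_le_trans xt).
- apply: continuous_subspaceW cF => x /=; rewrite !in_itv/= => /andP[-> xt].
  exact: le_trans t1.
by rewrite mul0r => /eqP; rewrite subr_eq0 => /eqP.
Qed.

Lemma rl_bounded_conv1 f u M : rl_class f -> measurable_fun [set: R] u ->
  rl_bounded M 1 u -> exists K, rl_bounded K 1 (conv f u).
Proof.
move=> [mf [C [a [a0 fC]]]] m_u uM.
have := conv_bound a0 ltr01 mf m_u fC uM.
by move=> /rl_bounded_le h; eexists; apply: h => //; rewrite lerDr ltW.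
Qed.

(** The two integrands agree at every point, including the ends of [0, t]: at
    s = 0 because eps vanishes there, at s = t because 0 to a negative power
    is 0. *)
Lemma caputo_integralE (alpha : R) (eps e : R -> R) t :
  0 < alpha < 1 -> eps 0 = 0 -> rl_class e ->
  (forall x, 0 < x <= 1 -> e x = eps x) -> 0 <= t <= 1 ->
  caputo_integral alpha eps t = Gamma (1 - alpha) * conv (rlker (1 - alpha)) e t.
Proof.
move=> /andP[al0 al1] eps0 ec eE /andP[t0 t1].
have b0 : 0 < 1 - alpha by rewrite subr_gt0.
have bc := rl_class_rlker b0.
rewrite /conv -RintegralZl//; last exact: integrable_conv.
rewrite /caputo_integral Rintegral_mkcond; apply: eq_Rintegral => s _.
have G0 : Gamma (1 - alpha) != 0 by rewrite gt_eqF// Gamma_gt0.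
rewrite patchE eps0 subr0 /rlker [X in X * e s]mulrC !mulrA divff// mul1r.
case: ifPn; rewrite ?inE ?notin_setE/= in_itv/=.
  move=> /andP[s0 st]; move: s0; rewrite le_eqVlt => /predU1P[<-|s0].
    by rewrite eps0 (rl_class_vanish ec)// !mulr0.
  rewrite eE ?s0 ?(le_trans st)//; congr (_ * _).
  move: st; rewrite le_eqVlt => /predU1P[->|st].
    by rewrite subrr pospow_le0// powR0// oppr_eq0 gt_eqF.
  by rewrite pospow_gt0 ?subr_gt0// addrAC subrr add0r.
move=> /negP; rewrite negb_and -!ltNge => /orP[s0|ts].
  by rewrite (rl_class_vanish ec (ltW s0)) mulr0.
by rewrite pospow_le0 ?mul0r// subr_le0 ltW.
Qed.

(** The integrands differ at s = 0 only, where sigma need not vanish. *)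
Lemma ml_integralE (alpha lam tau : R) (sigma : R -> R) t :
  0 < alpha < 1 -> 0 < lam -> 0 < tau -> lam = (tau^-1) `^ alpha ->
  {within `[0, 1], continuous sigma} -> 0 <= t <= 1 ->
  \int[mu]_(s in `[0, t]) ((t - s) `^ (alpha - 1) *
     mittag_leffler alpha alpha (- (((t - s) / tau) `^ alpha)) * sigma s) =
  conv (ml_kernel alpha lam) (extend01 sigma) t.
Proof.
move=> /andP[al0 al1] lam0 tau0 lamE csigma /andP[t0 t1].
have hc := rl_class_ml_kernel al0 lam0.
have Sc := rl_class_extend01 csigma.
have mF : measurable_fun [set: R]
    (fun s => ml_kernel alpha lam (t - s) * extend01 sigma s).
  by apply: measurable_conv_integrand; exact: rl_class_measurable.
have E s : s \in `]0, t]%classic -> (t - s) `^ (alpha - 1) *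
     mittag_leffler alpha alpha (- (((t - s) / tau) `^ alpha)) * sigma s =
     ml_kernel alpha lam (t - s) * extend01 sigma s.
  rewrite inE/= in_itv/= => /andP[s0 st].
  rewrite extend01E ?s0 ?(le_trans st)//; congr (_ * _).
  rewrite /ml_kernel powRM ?subr_ge0 ?invr_ge0 ?(ltW tau0)// -lamE [_ * lam]mulrC.
  move: st; rewrite le_eqVlt => /predU1P[->|st].
    by rewrite subrr pospow_le0// powR0// subr_eq0 lt_eqF.
  by rewrite pospow_gt0// subr_gt0.
rewrite [LHS]/Rintegral -integral_itv_obnd_cbnd; last first.
  apply/measurable_EFinP; move: (measurable_funTS (D := `]0, t]%classic) mF).
  by apply: eq_measurable_fun => s sI; rewrite E.
transitivity (\int[mu]_(s in `]0, t])
    (ml_kernel alpha lam (t - s) * extend01 sigma s)).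
  rewrite /Rintegral; congr fine; apply: eq_integral => s sI.
  by congr EFin; exact: E.
rewrite Rintegral_mkcond; apply: eq_Rintegral => s _; rewrite patchE.
case: ifPn => //; rewrite notin_setE/= in_itv/= => /negP.
rewrite negb_and -leNgt -ltNge => /orP[s0|ts].
  by rewrite extend01_le0// mulr0.
by rewrite (rl_class_vanish hc) ?mul0r// subr_le0 ltW.
Qed.

Lemma extend01_lin (x y : R) (u v : R -> R) :
  extend01 (fun t => x * u t + y * v t) =
  (fun t => x * extend01 u t + y * extend01 v t).
Proof.
by apply/funext => t; rewrite /extend01; case: ifP => // _; rewrite !mulr0 addr0.
Qed.

Lemma within_continuous_lin (A : set R) (x y : R) (u v : R -> R) :
  {within A, continuous u} -> {within A, continuous v} ->
  {within A, continuous (fun t => x * u t + y * v t)}.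
Proof.
move=> /subspace_continuousP cu /subspace_continuousP cv.
apply/subspace_continuousP => t At.
by apply: cvgD; (apply: cvgM; first exact: cvg_cst); [exact: cu|exact: cv].
Qed.

End UnitInterval.

Section InitialValueProblem.
Context {R : realType}.
Variables (alpha k lam : R) (sigma : R -> R).
Hypotheses (halpha : 0 < alpha < 1) (lam_gt0 : 0 < lam).
Hypothesis hsigma : {within `[0, 1], continuous sigma}.

Let al0 : 0 < alpha. Proof. by case/andP: halpha. Qed.
Let be0 : 0 < 1 - alpha. Proof. by case/andP: halpha; rewrite subr_gt0. Qed.
Let be1 : 1 - alpha <= 1. Proof. by rewrite gerBl ltW. Qed.
Let al1 : alpha <= 1. Proof. by case/andP: halpha => _ /ltW. Qed.
Let G0 : Gamma (1 - alpha) != 0. Proof. by rewrite gt_eqF// Gamma_gt0. Qed.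
Let kc : rl_class (rlker alpha). Proof. exact: rl_class_rlker. Qed.
Let bc : rl_class (rlker (1 - alpha)). Proof. exact: rl_class_rlker. Qed.
Let c1 : rl_class (rlker (1 : R)). Proof. exact: rl_class_rlker. Qed.
Let Sc : rl_class (extend01 sigma). Proof. exact: rl_class_extend01. Qed.

Let conv_kb : conv (rlker alpha) (rlker (1 - alpha)) = rlker (1 : R).
Proof.
by apply/funext => t; rewrite (conv_rlker t al0 be0); congr (rlker _ t); ring.
Qed.

Let conv_bk : conv (rlker (1 - alpha)) (rlker alpha) = rlker (1 : R).
Proof.
by apply/funext => t; rewrite (conv_rlker t be0 al0); congr (rlker _ t); ring.
Qed.

Let rhs (eps : R -> R) t := k * sigma t + (- lam) * eps t.

(** The differential equation solved for the derivative of the Caputo integral,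
    with k = eta^(-alpha) and lam = tau^(-alpha). *)
Definition caputo_equation (eps : R -> R) :=
  forall x, 0 < x <= 1 ->
    diff_quot_within `[0, 1] (caputo_integral alpha eps) x
      --> Gamma (1 - alpha) * (k * sigma x + (- lam) * eps x).

(** Write D = k sigma - lam eps.  The equation says that g_(1-alpha) * eps - g_1 * D
    has zero derivative on ]0, 1[; it is continuous and vanishes at 0, so it is
    zero.  Convolving with g_alpha gives g_1 * (eps - g_alpha * D) = 0, hence the
    Volterra equation eps = g_alpha * D. *)
Lemma caputo_equation_ml (eps : R -> R) :
  {within `[0, 1], continuous eps} -> eps 0 = 0 -> caputo_equation eps ->
  forall t, 0 <= t <= 1 ->
    eps t = k * conv (ml_kernel alpha lam) (extend01 sigma) t.
Proof.
move=> ceps eps0 heq.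
pose e := extend01 eps; pose D := extend01 (rhs eps).
have cv : {within `[0, 1], continuous (rhs eps)} by exact: within_continuous_lin.
have ec : rl_class e by exact: rl_class_extend01.
have Dc : rl_class D by exact: rl_class_extend01.
have [Me _ /rl_bounded_extend01 eM] := extend01_bounded ceps.
have [MD _ /rl_bounded_extend01 DM] := extend01_bounded cv.
have me := rl_class_measurable ec; have mD := rl_class_measurable Dc.
have JE (t : R) : 0 <= t <= 1 ->
    caputo_integral alpha eps t = Gamma (1 - alpha) * conv (rlker (1 - alpha)) e t.
  by move=> t01; apply: caputo_integralE => // x x01; exact: extend01E.
have bec := rl_class_conv bc ec; have c1D := rl_class_conv c1 Dc.
have integrated (t : R) : t <= 1 ->
    conv (rlker (1 - alpha)) e t = conv (rlker 1) D t.
  move=> t1; have [t0|t0] := leP t 0.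
    by rewrite (rl_class_vanish bec t0) (rl_class_vanish c1D t0).
  pose Phi := fun t => 1 * conv (rlker (1 - alpha)) e t + (-1) * conv (rlker 1) D t.
  have cPhi : {within `[0, 1], continuous Phi}.
    by apply: within_continuous_lin;
      [exact: (conv_rlker_within_continuous be0 be1 me eM)
      |exact: (conv_rlker_within_continuous ltr01 (lexx 1) mD DM)].
  have dPhi (x : R) : 0 < x < 1 -> is_derive x 1 Phi 0.
    move=> /andP[x0 x1]; have x01 : 0 < x <= 1 by rewrite x0 ltW.
    have nx : nbhs x `[0, 1]%classic.
      apply: (filterS _ (near_in_itvoo (_ : x \in `]0, 1[))) => [y|].
        by rewrite /= !in_itv/= => /andP[/ltW-> /ltW].
      by rewrite in_itv/= x0 x1.
    have dJ := @diff_quot_withinZ _ _ _ _ (Gamma (1 - alpha))^-1 _ (heq x x01).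
    rewrite mulKf// in dJ.
    have dB : is_derive x 1 (conv (rlker (1 - alpha)) e) (rhs eps x).
      apply: (is_derive_diff_quot_within nx).
      apply: eq_diff_quot_within dJ => [|y]; rewrite /= in_itv/=.
        by rewrite ltW// ltW.
      by move=> y01; rewrite JE// mulKf.
    have d1 := is_derive_conv1_extend01 cv x0.
    rewrite extend01E// in d1.
    have -> : (0 : R) = 1 *: rhs eps x + (-1) *: rhs eps x.
      by rewrite scale1r scaleN1r subrr.
    exact: is_deriveD.
  have Phi0 : Phi 0 = 0.
    rewrite /Phi (rl_class_vanish bec (lexx 0)) (rl_class_vanish c1D (lexx 0)).
    by rewrite !mulr0 addr0.
  have t01 : 0 <= t <= 1 by rewrite t1 ltW.
  have := within01_constant cPhi dPhi t01.
  by rewrite Phi0 /Phi mul1r mulN1r => /eqP; rewrite subr_eq0 => /eqP.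
pose w (t : R) := 1 * eps t + (-1) * conv (rlker alpha) D t.
have cw : {within `[0, 1], continuous w}.
  by apply: within_continuous_lin => //;
    exact: (conv_rlker_within_continuous al0 al1 mD DM).
have kDc : rl_class (conv (rlker alpha) D) by exact: rl_class_conv.
have ewE (t : R) : t <= 1 -> extend01 w t = 1 * e t + (-1) * conv (rlker alpha) D t.
  move=> t1; have [t0|t0] := leP t 0.
    by rewrite /e !extend01_le0// (rl_class_vanish kDc)// !mulr0 addr0.
  by rewrite /e !extend01E ?t0.
have w0 : forall t : R, 0 < t <= 1 -> w t = 0.
  apply: (conv1_extend01_eq0 cw) => t /andP[_ t1].
  rewrite (@eq_conv _ _ (rlker 1) _ _ _ c1 (rl_class_extend01 cw) _ ewE)//.
  rewrite conv_lin// mul1r mulN1r; apply/eqP; rewrite subr_eq0; apply/eqP.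
  have mk := rl_class_measurable.
  have comm : conv (rlker alpha) (rlker 1) = conv (rlker (1 : R)) (rlker alpha).
    by apply/funext => s; apply: convC; exact: mk.
  transitivity (conv (rlker alpha) (conv (rlker (1 - alpha)) e) t).
    exact: esym (etrans (convA kc bc ec t1)
      (congr1 (fun f => conv f e t) conv_kb)).
  apply: etrans (eq_conv kc (rl_class_conv bc ec) (fun x _ => erefl) integrated t1) _.
  exact: etrans (convA kc c1 Dc t1) (etrans (congr1 (fun f => conv f D t) comm)
    (esym (convA c1 kc Dc t1))).
have volt (t : R) : t <= 1 -> e t = conv (rlker alpha)
    (fun s => k * extend01 sigma s + (- lam) * e s) t.
  move=> t1; rewrite -extend01_lin -/(rhs eps) -/D.
  have [t0|t0] := leP t 0; first by rewrite /e extend01_le0// (rl_class_vanish kDc).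
  have t01 : 0 < t <= 1 by rewrite t0.
  have := w0 t t01; rewrite /w mul1r mulN1r => /eqP; rewrite subr_eq0 => /eqP <-.
  exact: extend01E.
have ml := (volterra_ml_kernel al0 lam_gt0 k Sc ec).1 volt.
move=> t /andP[t0 t1]; rewrite -ml//.
move: t0; rewrite le_eqVlt => /predU1P[<-|t0].
  by rewrite eps0 /e extend01_le0.
by rewrite /e extend01E// t0.
Qed.

(** The formula first gives a bounded function in the convolution class; the
    Volterra equation then shows that it is a fractional integral of a bounded
    function D, hence continuous.  Finally
    g_(1-alpha) * eps = g_(1-alpha) * g_alpha * D = g_1 * D, whose derivative is
    D. *)
Lemma ml_caputo_equation (eps : R -> R) :
  (forall t, 0 <= t <= 1 ->
    eps t = k * conv (ml_kernel alpha lam) (extend01 sigma) t) ->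
  [/\ {within `[0, 1], continuous eps}, eps 0 = 0 & caputo_equation eps].
Proof.
move=> epsE; have hc := rl_class_ml_kernel al0 lam_gt0.
(* eps itself is arbitrary outside [0, 1]; e agrees with it there and lies in the
   convolution class. *)
pose e (t : R) := k * conv (ml_kernel alpha lam) (extend01 sigma) t +
  0 * extend01 sigma t.
have hSc := rl_class_conv hc Sc.
have ec : rl_class e by exact: rl_class_lin.
have eE t : e t = k * conv (ml_kernel alpha lam) (extend01 sigma) t.
  by rewrite /e mul0r addr0.
have eeps (x : R) : 0 <= x <= 1 -> e x = eps x by move=> x01; rewrite eE epsE.
have eps0 : eps 0 = 0.
  by rewrite -eeps ?lexx ?ler01// (rl_class_vanish ec).
have volt := (volterra_ml_kernel al0 lam_gt0 k Sc ec).2 (fun t _ => eE t).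
pose D (t : R) := k * extend01 sigma t + (- lam) * e t.
have Dc : rl_class D by exact: rl_class_lin.
have [M DM] : exists M, rl_bounded M 1 D.
  have [MS _ /rl_bounded_extend01 SM] := extend01_bounded hsigma.
  have [K hK] := rl_bounded_conv1 hc (rl_class_measurable Sc) SM.
  exists (`|k| * MS + lam * (`|k| * K)) => t t1.
  rewrite /D eE (le_trans (ler_normD _ _))// !normrM normrN (gtr0_norm lam_gt0).
  by rewrite mulrDl -!mulrA lerD// !ler_wpM2l ?SM ?hK// ltW.
have ckD := conv_rlker_within_continuous al0 al1 (rl_class_measurable Dc) DM.
have ceps : {within `[0, 1], continuous eps}.
  apply: (subspace_eq_continuous (f := conv (rlker alpha) D)) ckD => x.
  rewrite inE/= in_itv/= => x01; have /andP[_ x1] := x01.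
  by transitivity (e x); [exact/esym/volt|exact: eeps].
split => // x x01; have /andP[x0 x1] := x01.
have cv : {within `[0, 1], continuous (rhs eps)} by exact: within_continuous_lin.
have d1 := @diff_quot_within_is_derive _ `[0, 1] _ _ _
  (is_derive_conv1_extend01 cv x0).
rewrite extend01E// in d1.
apply: eq_diff_quot_within (@diff_quot_withinZ _ _ _ _ (Gamma (1 - alpha)) _ d1) => [|t].
  by rewrite /= in_itv/= ltW.
rewrite /= in_itv/= => t01; have /andP[t0 t1] := t01.
rewrite (@caputo_integralE _ alpha eps e)//; last first.
  by move=> y /andP[y0 y1]; apply: eeps; rewrite (ltW y0).
have rhsD y : y <= 1 -> extend01 (rhs eps) y = D y.
  move=> y1; have [y0|y0] := leP y 0.
    by rewrite extend01_le0// (rl_class_vanish Dc).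
  have y01 : 0 < y <= 1 by rewrite y0.
  rewrite /D !extend01E// eeps//.
  by rewrite y1 (ltW y0).
apply: (congr1 (fun z => Gamma (1 - alpha) * z)).
apply: etrans (eq_conv c1 (rl_class_extend01 cv) (fun x _ => erefl) rhsD t1) _.
apply: etrans (esym (congr1 (fun f => conv f D t) conv_bk)) _.
apply: etrans (esym (convA bc kc Dc t1)) _.
exact: (eq_conv bc (rl_class_conv kc Dc) (fun x _ => erefl)
  (fun y y1 => esym (volt y y1)) t1).
Qed.

End InitialValueProblem.

Unset Implicit Arguments.

Theorem theorem1 (R : realType) (alpha E eta tau : R) (sigma : R -> R)
    (halpha : 0 < alpha < 1) (hE : 0 < E) (heta : 0 < eta)
    (htau : tau = eta / E)
    (hsigma : {within `[0, 1], continuous sigma}) :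
  forall eps : R -> R,
    is_ivp_solution alpha E eta sigma eps <->
    (forall t : R, 0 <= t <= 1 ->
       eps t = (eta `^ alpha)^-1 *
         \int[@lebesgue_measure R]_(s in `[0, t])
           ((t - s) `^ (alpha - 1) *
            mittag_leffler alpha alpha (- (((t - s) / tau) `^ alpha)) *
            sigma s)).
Proof.
move=> eps.
have tau0 : 0 < tau by rewrite htau divr_gt0.
have etaa : eta `^ alpha != 0 by rewrite gt_eqF// powR_gt0.
pose k := (eta `^ alpha)^-1; pose lam := (tau^-1) `^ alpha.
have lam0 : 0 < lam by rewrite powR_gt0// invr_gt0.
have lamE : lam = k * E `^ alpha.
  rewrite /lam htau invf_div powRM ?invr_ge0 ?(ltW hE) ?(ltW heta)// mulrC.
  by rewrite /k -[eta^-1]powR_inv1 ?(ltW heta)// powRAC powR_inv1 ?powR_ge0.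
have al1 : 0 < 1 - alpha by case/andP: halpha; rewrite subr_gt0.
have G0 : Gamma (1 - alpha) != 0 by rewrite gt_eqF// Gamma_gt0.
have formulaE : (forall t : R, 0 <= t <= 1 ->
    eps t = k * conv (ml_kernel alpha lam) (extend01 sigma) t) <->
  (forall t : R, 0 <= t <= 1 -> eps t = (eta `^ alpha)^-1 *
     \int[@lebesgue_measure R]_(s in `[0, t])
           ((t - s) `^ (alpha - 1) *
            mittag_leffler alpha alpha (- (((t - s) / tau) `^ alpha)) *
            sigma s)).
  by split => h t t01; rewrite h// (ml_integralE halpha lam0 tau0).
rewrite -formulaE; split.
  move=> [ceps eps0 heq]; apply: caputo_equation_ml => //.
  move=> x x01; have [dJ] := heq x x01.
  rewrite /caputo => hx.
  suff <- : derive_within `[0, 1] (caputo_integral alpha eps) x =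
      Gamma (1 - alpha) * (k * sigma x + (- lam) * eps x) by exact: dJ.
  rewrite -hx lamE /k; field.
  by rewrite etaa.
move=> /(ml_caputo_equation halpha lam0 hsigma)[ceps eps0 heq]; split => // x x01.
have pF := within01_punctured_proper x01.
have hx := heq x x01; split; first exact: cvgP hx.
rewrite /caputo /derive_within (cvg_lim _ hx)// lamE /k; field.
by rewrite etaa.
Qed.
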